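(* Let $n\ge3$ be odd, let $\Omega\subset\mathbb{R}^n$ be a bounded and strictly convex domain with smooth boundary, and let $p\ge1$, $q\ge1$ with $pq>1$. Suppose that $(u,v)\in (C^{n,\varepsilon}_{loc}(\Omega)\cap C^{n-1}(\overline\Omega))^2$ (with some arbitrarily small $\varepsilon>0$) is a pair of positive classical solutions to $$\begin{cases}(-\Delta)^{\frac n2}u(x)=v^p(x), & x\in\Omega,\\ (-\Delta)^{\frac n2}v(x)=u^q(x), & x\in\Omega,\\ u(x)=-\Delta u(x)=\cdots=(-\Delta)^{\frac{n-1}2}u(x)=0, & x\in\mathbb{R}^n\setminus\Omega,\\ v(x)=-\Delta v(x)=\cdots=(-\Delta)^{\frac{n-1}2}v(x)=0, & x\in\mathbb{R}^n\setminus\Omega.\end{cases}$$ Then for any $x^0\in\partial\Omega$, there exists $\delta_0>0$ depending only on $x^0$ and $\Omega$ (in particular not on $p,q,u,v$) such that, for every $i=0,\dots,\frac{n-1}2$, the functions $(-\Delta)^iu$ and $(-\Delta)^iv$ are strictly monotone increasing along the inward normal direction $\nu^0$ in the region $$\tilde\Sigma_{\delta_0}=\{x\in\overline\Omega\mid 0\le (x-x^0)\cdot\nu^0\le\delta_0\}.$$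
   Context: $\nu^0$ is the unit inward normal vector of $\partial\Omega$ at $x^0$. A function $w$ is strictly monotone increasing along $\nu^0$ in a region $S$ if $w(x+t\nu^0)>w(x)$ whenever $t>0$ and $x,\,x+t\nu^0\in S$. Positive means $u,v>0$ in $\Omega$. For $n$ odd, $(-\Delta)^{\frac n2}u:=(-\Delta)^{\frac12}\big((-\Delta)^{\frac{n-1}2}u\big)$, where each $(-\Delta)^iu$ with $0\le i\le\frac{n-1}2$ is computed classically in $\Omega$ and is zero on $\mathbb{R}^n\setminus\Omega$, and for $0<\sigma<1$ $$(-\Delta)^\sigma w(x)=C_{n,\sigma}\lim_{\delta\to0^+}\int_{\mathbb{R}^n\setminus B_\delta(x)}\frac{w(x)-w(y)}{|x-y|^{n+2\sigma}}\,dy,$$ with $C_{n,\sigma}>0$ the usual normalization constant. $C^{n,\varepsilon}_{loc}(\Omega)$ is the usual local Hölder space. *)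

(* Defs.v *)
From HB Require Import structures.
From mathcomp Require Import all_boot all_order all_algebra.
From mathcomp Require Import all_classical all_reals all_analysis.

Set Implicit Arguments.
Unset Strict Implicit.
Unset Printing Implicit Defensive.

Import Order.TTheory GRing.Theory Num.Theory.
Import numFieldNormedType.Exports.

Local Open Scope classical_set_scope.
Local Open Scope ring_scope.

(* The library norm on ['rV[R]_n] is the sup norm.  It is used below only
   through its topology and its bounded sets; lengths, balls and Hoelder
   quotients are Euclidean. *)
Section euclidean.
Context {R : realType} {n : nat}.
Implicit Types x y : 'rV[R]_n.

Definition dot x y : R := \sum_(i < n) x 0 i * y 0 i.

Definition enorm x : R := Num.sqrt (dot x x).

End euclidean.

(* Lebesgue measure on R^n is the n-fold product of [lebesgue_measure], built on
   [n.-tuple] because that type carries the product sigma-algebra. *)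
Section lebesgue_tuple.
Context {R : realType}.
Local Notation RT := (measurableTypeR R).

Definition tcons n (z : RT * n.-tuple RT) : n.+1.-tuple RT :=
  [the n.+1.-tuple RT of z.1 :: z.2].

Lemma measurable_tcons n : measurable_fun setT (@tcons n).
Proof. exact: measurable_cons. Qed.

HB.instance Definition _ n :=
  isMeasurableFun.Build _ _ _ _ (@tcons n) (@measurable_tcons n).

Section successor.
Variables (n : nat) (mu : {measure set (n.-tuple RT) -> \bar R}).

Definition lebesgue_tupleS : set (n.+1.-tuple RT) -> \bar R :=
  pushforward (lebesgue_measure \x^ mu)%E (@tcons n).

Let lebesgue_tupleS0 : lebesgue_tupleS set0 = 0%E.
Proof. exact: measure0. Qed.

Let lebesgue_tupleS_ge0 A : (0 <= lebesgue_tupleS A)%E.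
Proof. exact: measure_ge0. Qed.

Let lebesgue_tupleS_sigma_additive : semi_sigma_additive lebesgue_tupleS.
Proof. exact: measure_semi_sigma_additive. Qed.

HB.instance Definition _ := isMeasure.Build _ _ _ lebesgue_tupleS
  lebesgue_tupleS0 lebesgue_tupleS_ge0 lebesgue_tupleS_sigma_additive.

End successor.

Fixpoint lebesgue_tuple n : {measure set (n.-tuple RT) -> \bar R} :=
  if n is m.+1 then lebesgue_tupleS (lebesgue_tuple m)
  else \d_([tuple] : 0.-tuple RT).

Lemma lebesgue_tuple_box n (A : 'I_n -> set RT) :
  (forall i, measurable (A i)) ->
  lebesgue_tuple n [set t | forall i, A i (tnth t i)] =
  (\prod_(i < n) lebesgue_measure (A i))%E.
Proof.
elim: n A => [|n IH] A mA /=.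
  by rewrite big_ord0 /dirac indicE mem_set// => -[].
rewrite big_ord_recl -IH; last by move=> i; exact: mA.
have mB : measurable [set t : n.-tuple RT | forall i, A (lift ord0 i) (tnth t i)].
  rewrite (_ : mkset _ =
    \bigcap_(i in [set: 'I_n]) ((@tnth n RT)^~ i @^-1` A (lift ord0 i))).
    apply: fin_bigcap_measurable; first exact: finite_finset.
    move=> i _; rewrite -[X in measurable X]setTI.
    by apply: (measurable_tnth i) => //; exact: mA.
  by apply/seteqP; split=> t /= H i; [move=> _|]; exact: H.
rewrite -product_measure2E// /lebesgue_tupleS /pushforward /=.
congr ((_ \x^ _)%E _); apply/seteqP; split=> -[x t] /=.
  move=> H; split; first by have := H ord0.
  by move=> i; have := H (lift ord0 i); rewrite tnthS.
move=> [H0 H] i; case: (unliftP ord0 i) => [j ->|->//].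
by rewrite tnthS; exact: H.
Qed.

Definition integralRn n (D : set 'rV[R]_n) (f : 'rV[R]_n -> R) : R :=
  let row (t : n.-tuple RT) : 'rV[R]_n := \row_i tnth t i in
  Rintegral (lebesgue_tuple n) (row @^-1` D) (f \o row).

End lebesgue_tuple.

Section smoothness.
Context {R : realType} {n : nat}.
Implicit Types (U : set 'rV[R]_n) (f : 'rV[R]_n -> R) (s : seq 'I_n).

Definition partial (i : 'I_n) f : 'rV[R]_n -> R := 'D_(delta_mx 0 i) f.

(* For C^k functions the order of differentiation is irrelevant, so the
   words [s] of size k cover exactly the multi-indices of order k. *)
Definition partials s f : 'rV[R]_n -> R := foldr partial f s.

Definition grad f x : 'rV[R]_n := \row_i partial i f x.

Definition neg_laplacian f : 'rV[R]_n -> R :=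
  fun x => - \sum_(i < n) partial i (partial i f) x.

Definition C_open (k : nat) U f : Prop :=
  (forall s i x, (size s < k)%N -> U x ->
     derivable (partials s f) x (delta_mx 0 i)) /\
  (forall s x, (size s <= k)%N -> U x -> {for x, continuous (partials s f)}).

Definition smooth U f : Prop := forall k, C_open k U f.

Definition C_closure (k : nat) U f : Prop :=
  [/\ C_open k U f,
      {within closure U, continuous f} &
      forall s, (size s <= k)%N ->
        exists2 g : 'rV[R]_n -> R, {within closure U, continuous g} &
          forall x, U x -> g x = partials s f x].

Definition C_holder_loc (k : nat) (eps : R) U f : Prop :=
  C_open k U f /\
  forall K : set 'rV[R]_n, compact K -> K `<=` U ->
    forall s, size s = k -> exists C : R, forall x y, K x -> K y ->
      `|partials s f x - partials s f y| <= C * enorm (x - y) `^ eps.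

End smoothness.

Section domains.
Context {R : realType} {n : nat}.
Implicit Types (Omega U : set 'rV[R]_n) (x nu : 'rV[R]_n).

Definition boundary Omega : set 'rV[R]_n := closure Omega `\` Omega°.

Definition domain Omega : Prop :=
  [/\ open Omega, connected Omega & Omega !=set0].

Definition strictly_convex Omega : Prop :=
  forall x y (t : R), closure Omega x -> closure Omega y -> x != y ->
    0 < t < 1 -> Omega° (t *: x + (1 - t) *: y).

Definition local_defining_function Omega x U (rho : 'rV[R]_n -> R) : Prop :=
  [/\ open U, U x, smooth U rho, (forall y, U y -> grad rho y != 0) &
      forall y, U y -> (Omega y <-> 0 < rho y)].

Definition smooth_boundary Omega : Prop :=
  forall x, boundary Omega x ->
    exists U rho, local_defining_function Omega x U rho.

(* [rho] is positive inside, so its gradient points inward. *)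
Definition inward_unit_normal Omega x nu : Prop :=
  exists U rho, local_defining_function Omega x U rho /\
    nu = (enorm (grad rho x))^-1 *: grad rho x.

Definition cap Omega x0 nu (delta : R) : set 'rV[R]_n :=
  [set x | closure Omega x /\ 0 <= dot (x - x0) nu <= delta].

Definition strictly_increasing_along nu (w : 'rV[R]_n -> R)
    (S : set 'rV[R]_n) : Prop :=
  forall x (t : R), 0 < t -> S x -> S (x + t *: nu) -> w x < w (x + t *: nu).

End domains.

Section fractional_laplacian.
Context {R : realType} {n : nat}.
Implicit Types (Omega : set 'rV[R]_n) (u v w : 'rV[R]_n -> R).

Definition Gamma (s : R) : R :=
  \int[@lebesgue_measure R]_(t in `]0, +oo[) (t `^ (s - 1) * expR (- t)).

(* The usual 4^sigma Gamma(n/2 + sigma) / (pi^(n/2) |Gamma(-sigma)|), rewritten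
   with |Gamma(-sigma)| = Gamma(1 - sigma) / sigma for 0 < sigma < 1. *)
Definition frac_const (sigma : R) : R :=
  sigma * 4 `^ sigma * Gamma (n%:R / 2 + sigma) /
  (pi `^ (n%:R / 2) * Gamma (1 - sigma)).

Definition frac_laplacian (sigma : R) w x : R :=
  frac_const sigma *
  lim (integralRn [set y | delta <= enorm (x - y)]
         (fun y => (w x - w y) / enorm (x - y) `^ (n%:R + 2 * sigma))
       @[delta --> 0^'+]).

Definition boundary_extension Omega w x : R :=
  if x \in boundary Omega then lim (w y @[y --> within Omega (nbhs x)])
  else w x.

(* (-Delta)^i u on R^n: classical off the boundary of Omega and, on the boundary,
   the continuous extension from Omega that C^{n-1}(closure Omega) provides.
   Hence the vanishing on the complement of Omega required in
   [navier_exterior] is a genuine condition at the boundary. *)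
Definition neg_laplacian_iter Omega (i : nat) u : 'rV[R]_n -> R :=
  boundary_extension Omega (iter i neg_laplacian u).

(* (-Delta)^{n/2} for odd n. *)
Definition half_power_laplacian Omega u : 'rV[R]_n -> R :=
  frac_laplacian 2^-1 (neg_laplacian_iter Omega n.-1./2 u).

Definition navier_exterior Omega u : Prop :=
  forall i x, (i <= n.-1./2)%N -> ~ Omega x -> neg_laplacian_iter Omega i u x = 0.

Definition solution Omega (p q : R) u v : Prop :=
  [/\ forall x, Omega x -> half_power_laplacian Omega u x = v x `^ p,
      forall x, Omega x -> half_power_laplacian Omega v x = u x `^ q,
      navier_exterior Omega u & navier_exterior Omega v].

Definition positive_in Omega u : Prop := forall x, Omega x -> 0 < u x.

Definition solution_class Omega (eps : R) u : Prop :=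
  C_holder_loc n eps Omega u /\ C_closure n.-1 Omega u.

End fractional_laplacian.

(* Main.v *)
From HB Require Import structures.
Require Import Defs.
From mathcomp Require Import all_boot all_order all_algebra.
From mathcomp Require Import all_classical all_reals all_analysis.
From mathcomp Require Import measurable_realfun ring lra.
Import Order.TTheory GRing.Theory Num.Theory.
Import numFieldNormedType.Exports.
Local Open Scope classical_set_scope.
Local Open Scope ring_scope.
Set Implicit Arguments.
Unset Strict Implicit.
Unset Printing Implicit Defensive.

(* The functions U_i = (-Delta)^i u, V_i = (-Delta)^i v satisfy
   -Delta U_i = U_{i+1} for i < m = (n-1)/2 and (-Delta)^{1/2} U_m = V_0^p, and
   symmetrically for V, so all of them are positive in Omega by the maximum
   principle.  We move the planes {(x - x0).nu = lam}: if R_lam is the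
   reflection in such a plane, the claim is that w_i = U_i o R_lam - U_i is
   positive below the plane as long as R_lam maps the cap below it into Omega,
   which holds for all lam up to a height depending on x0 and Omega only.  The
   plane advances by a narrow-region argument.  Assume that nonnegativity can
   fail only in a strip of width l below the plane, and let -A < 0 be the
   minimum of w_m and of its analogue z_m for v, attained by w_m at x.  The
   barrier A s^2, s being the distance to the plane, gives z_0 >= -A l^2, hence
   (-Delta)^{1/2} w_m(x) >= -C A l^2 because t |-> t^p is locally Lipschitz,
   while antisymmetry of w_m gives (-Delta)^{1/2} w_m(x) <= -c A, with c > 0
   independent of l; this is absurd for small l.

   No regularity is needed to make sense of (-Delta)^{1/2}.  Both lim (without
   limit) and Rintegral (of a nonintegrable function) have junk value 0, and
   (-Delta)^{1/2} U_m = V_0^p > 0, so the principal value converges and the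
   truncated integrals are finite.  For the same reason the normalization
   constant, which is obviously >= 0, is > 0. *)

(** * Lebesgue measure on tuples *)

(** The narrow-region argument only returns w_i >= 0, and its width l depends on the solution.
    Moving beyond the supremum s of the admissible heights therefore needs w_i > 0 below the plane
    at s: this positivity persists on the compact set of points of height at most s - l/2 when the
    plane moves a little, which leaves only a strip of width l uncontrolled. Strictness originates
    at x0: U_m vanishes there while the mirror image of x0 lies in Omega, so w_m > 0 near x0, and a
    zero of w_m below the plane would make (-Delta)^{1/2} w_m negative, against z_0 >= 0. Since
    heights are nonnegative on the closure of Omega, the same step at s = 0 starts the procedure.
    Monotonicity follows because x and x + t nu are mirror images in the plane halfway between them.

    A reflection does not map boxes to boxes, so invariance of the product measure under it is not a
    coordinatewise fact; it is derived from translation invariance, in the manner of the uniqueness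
    of Haar measure. *)

Section tuple_measure.
Context {R : realType} {n : nat}.
Local Notation RT := (measurableTypeR R).
Local Notation T := (n.-tuple RT).
Implicit Types (s t : T) (A B : set T).

Definition box (I : 'I_n -> set RT) : set T := [set t | forall i, I i (tnth t i)].

Lemma boxE I : box I = \bigcap_(i in [set: 'I_n]) ((@tnth n RT)^~ i @^-1` I i).
Proof. by apply/seteqP; split=> t /= H i; [move=> _|]; exact: H. Qed.

Lemma measurable_box I : (forall i, measurable (I i)) -> measurable (box I).
Proof.
move=> mI; rewrite boxE; apply: fin_bigcap_measurable; first exact: finite_finset.
move=> i _; rewrite -[X in measurable X]setTI.
by apply: (measurable_tnth i) => //; exact: mI.
Qed.

Definition box_class : set (set T) :=
  [set A | exists2 I, (forall i, measurable (I i)) & A = box I].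

(** The generating coordinate cylinders are boxes with all other sides full. Boxes, unlike
    cylinders, are closed under intersection, as uniqueness of measures demands. *)
Lemma measurable_tupleE : @measurable _ T = <<s box_class >>.
Proof.
apply/seteqP; split; last first.
  apply: smallest_sub; first exact: sigma_algebra_measurable.
  by move=> _ [I mI ->]; exact: measurable_box.
apply: smallest_sub; first exact: smallest_sigma_algebra.
move=> A; rewrite -bigcup_seq => -[i _] [B mB <-].
apply: sub_sigma_algebra.
exists (fun j => if j == i then B else setT).
  by move=> j; case: ifP.
rewrite setTI; apply/seteqP; split=> t /=.
  by move=> Bt j; case: eqP => [->|].
by move/(_ i); rewrite eqxx.
Qed.

Lemma box_class_setI : setI_closed box_class.
Proof.
move=> _ _ [I mI ->] [J mJ ->]; exists (fun i => I i `&` J i).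
  by move=> i; exact: measurableI.
by apply/seteqP; split=> t /=; [move=> [h k] i; split|move=> h; split=> i; have [] := h i].
Qed.

Definition cube (k : nat) : set T := box (fun=> `[- k%:R, k%:R]%classic).

Lemma measurable_cube k : measurable (cube k).
Proof. by apply: measurable_box => i; exact: measurable_itv. Qed.

Lemma cube_cover : \bigcup_k cube k = setT.
Proof.
apply/seteqP; split=> // t _.
have [k hk] : exists k : nat, forall i, `|tnth t i| <= k%:R.
  exists (\max_i (Num.truncn `|tnth t i|).+1)%N => i.
  have := truncnS_gt `|tnth t i|; move=> /ltW /le_trans; apply.
  by rewrite ler_nat; apply: leq_bigmax.
by exists k => // i /=; rewrite in_itv/= -ler_norml.
Qed.

Lemma lebesgue_tuple_cube_lty k : (lebesgue_tuple n (cube k) < +oo)%E.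
Proof.
rewrite lebesgue_tuple_box; last by move=> i; exact: measurable_itv.
rewrite (eq_bigr (fun=> (k%:R - - k%:R)%:E)); last first.
  move=> i _; rewrite lebesgue_measure_itv/= lte_fin.
  case: ltP => // h; congr EFin; apply/eqP; rewrite eq_sym subr_eq0.
  by rewrite eq_le h/= (@le_trans _ _ 0)// oppr_le0.
have [r ->] : exists r, (\prod_(i < n) (k%:R - - k%:R)%:E = r%:E :> \bar R)%E.
  elim/big_rec: _ => [|i x _ [r ->]]; first by exists 1.
  by eexists; rewrite -EFinM.
by rewrite ltry.
Qed.

(** Reduces translation invariance to one coordinate at a time. *)
Lemma lebesgue_tuple_unique (m : {measure set T -> \bar R}) :
  (forall I, (forall i, measurable (I i)) ->
    m (box I) = (\prod_(i < n) lebesgue_measure (I i))%E) ->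
  forall A, measurable A -> lebesgue_tuple n A = m A.
Proof.
move=> H; apply: (measure_unique box_class cube).
- exact: measurable_tupleE.
- exact: box_class_setI.
- by move=> k; exists (fun=> `[- k%:R, k%:R]%classic) => // i; exact: measurable_itv.
- exact: cube_cover.
- by move=> _ [I mI ->]; rewrite H// lebesgue_tuple_box.
- exact: lebesgue_tuple_cube_lty.
Qed.

Definition tadd s t : T := [tuple tnth s i + tnth t i | i < n].
Definition topp t : T := [tuple - tnth t i | i < n].

Lemma tnth_tadd s t i : tnth (tadd s t) i = tnth s i + tnth t i.
Proof. by rewrite tnth_mktuple. Qed.
Lemma tnth_topp t i : tnth (topp t) i = - tnth t i.
Proof. by rewrite tnth_mktuple. Qed.

Lemma measurable_tadd d (S : measurableType d) (f g : S -> T) :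
  measurable_fun setT f -> measurable_fun setT g ->
  measurable_fun setT (fun x => tadd (f x) (g x)).
Proof.
move=> /measurable_fun_tnthP mf /measurable_fun_tnthP mg.
apply/measurable_fun_tnthP => i.
rewrite (_ : _ \o _ = fun x => tnth (f x) i + tnth (g x) i).
  by apply: measurable_funD; [exact: mf|exact: mg].
by apply/funext => x /=; rewrite tnth_tadd.
Qed.

Lemma measurable_topp d (S : measurableType d) (f : S -> T) :
  measurable_fun setT f -> measurable_fun setT (fun x => topp (f x)).
Proof.
move=> /measurable_fun_tnthP mf.
apply/measurable_fun_tnthP => i.
rewrite (_ : _ \o _ = fun x => - tnth (f x) i).
  by apply: measurable_funN; exact: mf.
by apply/funext => x /=; rewrite tnth_topp.
Qed.

End tuple_measure.

Section shift1.
Context {R : realType}.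
Local Notation RT := (measurableTypeR R).

Lemma lebesgue_measure_shift (a : R) (A : set RT) : measurable A ->
  lebesgue_measure [set x | A (a + x)] = lebesgue_measure A.
Proof.
have mf : measurable_fun [set: RT] (fun x : RT => a + x : RT).
  by apply: measurable_funD => //; exact: measurable_cst.
move=> mA.
pose f : {mfun RT >-> RT} := HB.pack (fun x : RT => a + x : RT)
  (isMeasurableFun.Build _ _ _ _ _ mf).
have := @lebesgue_measure_unique R (pushforward (@lebesgue_measure R) f) _ A mA.
move=> -> // _ [[u v] _ <-] /=.
rewrite /pushforward.
rewrite (_ : _ @^-1` _ = `]u - a, v - a]%classic); last first.
  by apply/seteqP; split => x /=; rewrite !in_itv/= ltrBlDl lerBrDl.
rewrite !lebesgue_measure_itv/= !lte_fin ltrD2r.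
by case: ifP => // _; rewrite -!EFinB; congr EFin; ring.
Qed.

End shift1.

(** * Translation invariance and comparison of invariant measures *)

Section invariance.
Context {R : realType} {n : nat}.
Local Notation RT := (measurableTypeR R).
Local Notation T := (n.-tuple RT).
Implicit Types (s t : T) (A B : set T).

(** Closed by [Defined] so that [pushmeasureE] and later uses of [change] hold by conversion. *)
Definition pushmeasure (phi : T -> T) (mphi : measurable_fun setT phi)
    (m : {measure set T -> \bar R}) : {measure set T -> \bar R}.
Proof. by refine (pushforward m phi : {measure set T -> \bar R}). Defined.

Lemma pushmeasureE phi mphi m A : @pushmeasure phi mphi m A = m (phi @^-1` A).
Proof. by []. Qed.

Lemma measurable_taddl s : measurable_fun setT (tadd s).
Proof. by apply: measurable_tadd => //; exact: measurable_cst. Qed.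

Lemma lebesgue_tuple_shift s A : measurable A ->
  lebesgue_tuple n (tadd s @^-1` A) = lebesgue_tuple n A.
Proof.
move=> mA; rewrite -(pushmeasureE (measurable_taddl s)); apply/esym.
apply: lebesgue_tuple_unique => // I mI.
rewrite pushmeasureE.
rewrite (_ : _ @^-1` _ = box (fun i => [set x | I i (tnth s i + x)])); last first.
  by apply/seteqP; split => t /= h i; have := h i; rewrite tnth_tadd.
rewrite lebesgue_tuple_box.
  by apply: eq_bigr => i _; rewrite lebesgue_measure_shift.
move=> i; rewrite -[X in measurable X]setTI.
have mf : measurable_fun [set: RT] (fun x : RT => tnth s i + x : RT).
  by apply: measurable_funD => //; exact: measurable_cst.
exact: mf.
Qed.

Lemma measurable_preimage (f : T -> T) A : measurable_fun setT f ->
  measurable A -> measurable (f @^-1` A).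
Proof. by move=> mf mA; rewrite -[X in measurable X]setTI; exact: mf. Qed.

Definition shift_invariant (m : set T -> \bar R) :=
  forall s A, measurable A -> m (tadd s @^-1` A) = m A.

(* Tonelli on {(x, y) | A x, B (x + y)}, then x := x - y in the inner
   integral, and Tonelli again. *)
Lemma shift_invariant_swap (m1 m2 : {sigma_finite_measure set T -> \bar R}) A B :
  shift_invariant m1 -> shift_invariant m2 -> measurable A -> measurable B ->
  (m1 A * m2 B = m1 B * m2 (topp @^-1` A))%E.
Proof.
move=> inv1 inv2 mA mB.
(* Both sides of the identity have this shape: over each x in C the section is a translate of the
   preimage of D under [op], so [m2] gives it a value independent of x. *)
have slice (C D : set T) (sg op : T -> T) : measurable C -> measurable D ->
    measurable_fun setT op ->
    (m1 \x m2)%E [set z | C z.1 /\ D (op (tadd (sg z.1) z.2))] =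
    (m1 C * m2 (op @^-1` D))%E.
  move=> mC mD mop.
  have mopD : measurable (op @^-1` D) by exact: measurable_preimage.
  rewrite /product_measure1.
  rewrite (eq_integral (fun x => (\1_C x)%:E * m2 (op @^-1` D))%E).
    rewrite ge0_integralZr ?integral_indic ?setIT//; exact: measurableT_comp.
  move=> x _ /=; rewrite -(inv2 (sg x) (op @^-1` D))// indicE.
  have [xC|xC] := boolP (x \in C).
    rewrite mul1e; congr (m2 _); apply/seteqP; split=> y.
      by rewrite /xsection/= in_setE/= => -[].
    by rewrite /xsection/= in_setE/=; split=> //; rewrite -in_setE.
  rewrite mul0e (_ : xsection _ _ = set0) ?measure0//.
  apply/seteqP; split=> // y; rewrite /xsection/= in_setE/= => -[].
  by rewrite -in_setE (negbTE xC).
have mS (C D : set T) (f : T * T -> T) : measurable C -> measurable D ->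
    measurable_fun setT f -> measurable [set z | C z.1 /\ D (f z)].
  move=> mC mD mf; apply: measurableI.
    by rewrite -[X in measurable X]setTI; exact: measurable_fst.
  by rewrite -[X in measurable X]setTI; exact: mf.
have m12 C : measurable C -> (m1 \x m2)%E C = (m1 \x^ m2)%E C.
  by apply: product_measure_unique => D E mD mE; exact: product_measure2E.
rewrite -(slice A B id id) // -(slice B A topp topp) //; last first.
  exact: measurable_topp.
rewrite !m12; last 2 first.
- apply: (mS _ _ (fun z => topp (tadd (topp z.1) z.2))) => //.
  by apply: measurable_topp; apply: measurable_tadd => //; apply: measurable_topp.
- by apply: (mS _ _ (fun z => tadd z.1 z.2)) => //; apply: measurable_tadd.
rewrite /product_measure2; apply: eq_integral => y _ /=.
rewrite -[RHS](inv1 y); last first.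
  apply: measurable_ysection.
  apply: (mS _ _ (fun z => topp (tadd (topp z.1) z.2))) => //.
  by apply: measurable_topp; apply: measurable_tadd => //; apply: measurable_topp.
congr (m1 _); apply/seteqP; split=> x; rewrite /ysection/= !in_setE/= => -[h1 h2].
  have -> : tadd y x = tadd x y by apply: eq_from_tnth => i; rewrite !tnth_tadd addrC.
  split => //; have -> // : topp (tadd (topp (tadd x y)) y) = x.
  by apply: eq_from_tnth => i; rewrite !(tnth_tadd,tnth_topp); ring.
have <- : tadd y x = tadd x y by apply: eq_from_tnth => i; rewrite !tnth_tadd addrC.
split => //; have <- // : topp (tadd (topp (tadd y x)) y) = x.
by apply: eq_from_tnth => i; rewrite !(tnth_tadd,tnth_topp); ring.
Qed.

End invariance.

Section isometry.
Context {R : realType} {n : nat}.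
Local Notation RT := (measurableTypeR R).
Local Notation T := (n.-tuple RT).
Implicit Types (x y z : 'rV[R]_n).

Definition torow (t : T) : 'rV[R]_n := \row_i tnth t i.
Definition totuple x : T := [tuple x 0 i | i < n].

Lemma torowK : cancel torow totuple.
Proof. by move=> t; apply: eq_from_tnth => i; rewrite tnth_mktuple mxE. Qed.

Lemma totupleK : cancel totuple torow.
Proof. by move=> x; apply/rowP => i; rewrite mxE tnth_mktuple. Qed.

Lemma torow_tadd s t : torow (tadd s t) = torow s + torow t.
Proof. by apply/rowP => i; rewrite !mxE tnth_tadd. Qed.

Lemma torow_topp t : torow (topp t) = - torow t.
Proof. by apply/rowP => i; rewrite !mxE tnth_topp. Qed.

(** An open set is the union of the rational cubes it contains, and these are countably many; [F]
    sends the other indices to the empty set. *)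
Lemma measurable_torow_open (U : set 'rV[R]_n) : open U -> measurable (torow @^-1` U).
Proof.
move=> oU.
pose F (k : n.-tuple rat * rat) : set T :=
  if asbool (forall x, (forall i, `|x 0 i - ratr (tnth k.1 i)| < ratr k.2) -> U x)
  then box (fun i => [set z | `|z - ratr (tnth k.1 i)| < ratr k.2]) else set0.
rewrite (_ : _ @^-1` _ = \bigcup_k F k); last first.
  apply/seteqP; split => t /=; last first.
    move=> [k _]; rewrite /F; case: asboolP => // h /= Ht.
    by apply: h => i; rewrite mxE; exact: Ht.
  move=> Ut; have : nbhs (torow t) U by exact: open_nbhs_nbhs.
  move=> /nbhs_ballP[e e0 eU].
  have [r /itvP r0e] : exists r : rat, ratr r \in `]0, e / 2[.
    by apply: rat_in_itvoo; rewrite divr_gt0.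
  have hq i : exists q : rat, `|tnth t i - ratr q| < ratr r.
    have r0 : 0 < ratr r :> R by rewrite r0e.
    have tr : tnth t i - ratr r < tnth t i + ratr r :> R by lra.
    have [q] := @rat_in_itvoo R _ _ tr.
    by rewrite in_itv/= => /andP[q1 q2]; exists q; rewrite ltr_distlC q1 q2.
  have [q hq'] := boolp.choice hq.
  exists ([tuple q i | i < n], r) => //.
  rewrite /F; case: asboolP => [_|[]] /=; first by move=> i; rewrite /= tnth_mktuple.
  move=> x hx; apply: eU; split => // j i; rewrite ord1 mxE.
  have := hx i; have := hq' i; rewrite tnth_mktuple/= => a b.
  rewrite /ball/= (_ : _ - _ = (tnth t i - ratr (q i)) - (x 0 i - ratr (q i))); last by ring.
  rewrite (le_lt_trans (ler_normB _ _))//.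
  have : ratr r < e / 2 by rewrite r0e.
  lra.
apply: countable_bigcupT_measurable; first exact: countableP.
move=> k; rewrite /F; case: ifP => // _; apply: measurable_box => i.
rewrite (_ : mkset _ = `]ratr (tnth k.1 i) - ratr k.2, ratr (tnth k.1 i) + ratr k.2[%classic).
  exact: measurable_itv.
by apply/seteqP; split=> z /=; rewrite in_itv/= ltr_distl.
Qed.

Lemma measurable_torow_continuous (f : 'rV[R]_n -> R) : continuous f ->
  measurable_fun setT (f \o torow).
Proof.
move=> cf; apply: (measurability _ (RGenOpens.measurableE R)) => _ [_ [a [b ->] <-]].
rewrite setTI comp_preimage; apply: measurable_torow_open.
by move/continuousP: cf; apply; exact: interval_open.
Qed.

End isometry.

(** * Euclidean structure and reflections *)

Lemma cvg_sum {T : Type} {F : set_system T} {FF : Filter F} {K : numFieldType}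
    {V : normedModType K} {I : Type} (r : seq I) (P : pred I)
    (f : I -> T -> V) (a : I -> V) :
  (forall i, P i -> f i x @[x --> F] --> a i) ->
  \sum_(i <- r | P i) f i x @[x --> F] --> \sum_(i <- r | P i) a i.
Proof.
move=> fa; elim: r => [|i r IH].
  by under eq_fun do rewrite big_nil; rewrite big_nil; exact: cvg_cst.
under eq_fun do rewrite big_cons; rewrite big_cons.
by case: ifPn => // Pi; apply: cvgD => //; exact: fa.
Qed.

Section euclidean_lemmas.
Context {R : realType} {n : nat}.
Implicit Types x y z : 'rV[R]_n.

Lemma dotC x y : dot x y = dot y x.
Proof. by apply: eq_bigr => i _; rewrite mulrC. Qed.

Lemma dotDl x y z : dot (x + y) z = dot x z + dot y z.
Proof. by rewrite -big_split; apply: eq_bigr => i _; rewrite /= mxE mulrDl. Qed.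

Lemma dotZl a x y : dot (a *: x) y = a * dot x y.
Proof. by rewrite big_distrr; apply: eq_bigr => i _; rewrite /= mxE mulrA. Qed.

Lemma dotNl x y : dot (- x) y = - dot x y.
Proof. by rewrite -scaleN1r dotZl mulN1r. Qed.

Lemma dotBl x y z : dot (x - y) z = dot x z - dot y z.
Proof. by rewrite dotDl dotNl. Qed.

Lemma dotDr x y z : dot x (y + z) = dot x y + dot x z.
Proof. by rewrite dotC dotDl !(dotC x). Qed.

Lemma dotZr a x y : dot x (a *: y) = a * dot x y.
Proof. by rewrite dotC dotZl dotC. Qed.

Lemma dotNr x y : dot x (- y) = - dot x y.
Proof. by rewrite dotC dotNl dotC. Qed.

Lemma dotBr x y z : dot x (y - z) = dot x y - dot x z.
Proof. by rewrite dotDr dotNr. Qed.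

Lemma dot_ge0 x : 0 <= dot x x.
Proof. by apply: sumr_ge0 => i _; rewrite -expr2 sqr_ge0. Qed.

Lemma enorm_ge0 x : 0 <= enorm x.
Proof. exact: sqrtr_ge0. Qed.

Lemma enormN x : enorm (- x) = enorm x.
Proof. by rewrite /enorm dotNl dotNr opprK. Qed.

Lemma sqr_enorm x : enorm x ^+ 2 = dot x x.
Proof. by rewrite sqr_sqrtr// dot_ge0. Qed.

Lemma coord_le_enorm x i : `|x 0 i| <= enorm x.
Proof.
rewrite -sqrtr_sqr ler_wsqrtr// /dot (bigD1 i)//= -expr2 lerDl.
by apply: sumr_ge0 => j _; rewrite -expr2 sqr_ge0.
Qed.

Lemma coord_le_norm x i : `|x 0 i| <= `|x|.
Proof.
rewrite [leRHS]/Num.norm/= mx_normrE.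
by apply/bigmax_geP; right => /=; exists (ord0, i).
Qed.

Lemma norm_le x (a : R) : 0 <= a -> (forall i, `|x 0 i| <= a) -> `|x| <= a.
Proof.
move=> a0 h; rewrite [leLHS]/Num.norm/= mx_normrE.
by apply/bigmax_leP; split => // -[j i] _; rewrite /= ord1.
Qed.

Lemma norm_lt x (a : R) : 0 < a -> (forall i, `|x 0 i| < a) -> `|x| < a.
Proof.
move=> a0 h; rewrite [ltLHS]/Num.norm/= mx_normrE.
by apply/bigmax_ltP; split => // -[j i] _; rewrite /= ord1.
Qed.

Lemma ball_coordE x (r : R) : 0 < r ->
  ball x r = [set y | forall i, `|y 0 i - x 0 i| < r].
Proof.
move=> r0; rewrite -ball_normE; apply/seteqP; split=> y /= h.
  move=> i; apply: le_lt_trans h; rewrite distrC.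
  by have := coord_le_norm (x - y) i; rewrite !mxE.
by apply: norm_lt => // i; rewrite !mxE distrC.
Qed.

Lemma norm_le_enorm x : `|x| <= enorm x.
Proof. by apply: norm_le (enorm_ge0 x) _ => i; exact: coord_le_enorm. Qed.

Lemma dot_le_norm x y : `|dot x y| <= n%:R * `|x| * `|y|.
Proof.
apply: (le_trans (ler_norm_sum _ _ _)).
apply: (@le_trans _ _ (\sum_(i < n) `|x| * `|y|)).
  by apply: ler_sum => i _; rewrite normrM ler_pM// coord_le_norm.
by rewrite sumr_const card_ord -mulrA mulr_natl.
Qed.

Lemma enorm_le_norm x : enorm x <= n%:R * `|x|.
Proof.
rewrite -(@ler_pXn2r _ 2)// ?nnegrE ?enorm_ge0 ?mulr_ge0//.
rewrite sqr_enorm (le_trans (ler_norm _))// (le_trans (dot_le_norm _ _))//.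
rewrite exprMn -mulrA -expr2 ler_wpM2r ?sqr_ge0//.
by rewrite -natrX ler_nat; case: n => // k; rewrite expnS leq_pmulr// expn1.
Qed.

Lemma continuous_dotr y : continuous (fun x => dot x y).
Proof.
move=> x; apply: (@cvg_sum _ (nbhs x) _ R R^o _ _ _ (fun i x => x 0 i * y 0 i)) => i _.
by apply: cvgM; [exact: coord_continuous|exact: cvg_cst].
Qed.

Lemma continuous_enorm : continuous (@enorm R n).
Proof.
move=> x; apply: (@continuous_comp _ _ _ (fun x => dot x x) Num.sqrt).
  apply: (@cvg_sum _ (nbhs x) _ R R^o _ _ _ (fun i x => x 0 i * x 0 i)) => i _.
  by apply: cvgM; exact: coord_continuous.
exact: sqrt_continuous.
Qed.

Lemma enorm_gt0 x : (0 < enorm x) = (x != 0).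
Proof.
rewrite lt_neqAle enorm_ge0 andbT eq_sym; congr negb; apply/eqP/eqP => [x0|->].
  apply/eqP; rewrite -normr_le0 -x0; exact: norm_le_enorm.
by rewrite /enorm/dot big1 ?sqrtr0// => i _; rewrite mxE mul0r.
Qed.

End euclidean_lemmas.

Section reflection.
Context {R : realType} {n : nat}.
Implicit Types x y z b nu : 'rV[R]_n.

(** For a unit vector [nu], the Householder reflection: the linear part of [refl]. *)
Definition rlin nu y := y - (2 * dot y nu) *: nu.

Definition refl x0 nu (lam : R) y := y + (2 * (lam - dot (y - x0) nu)) *: nu.

Lemma refl_rlin x0 nu lam y :
  refl x0 nu lam y = (2 * (lam + dot x0 nu)) *: nu + rlin nu y.
Proof.
rewrite /refl /rlin dotBl addrCA; congr (_ + _).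
by rewrite -scaleNr -scalerDl; congr (_ *: _); ring.
Qed.

Lemma rlinD nu x y : rlin nu (x + y) = rlin nu x + rlin nu y.
Proof. by rewrite /rlin dotDl mulrDr scalerDl opprD addrACA. Qed.

Lemma rlinZ nu a x : rlin nu (a *: x) = a *: rlin nu x.
Proof. by rewrite /rlin dotZl scalerBr scalerA mulrCA. Qed.

Section unit.
Variable nu : 'rV[R]_n.
Hypothesis nu1 : dot nu nu = 1.

Lemma rlinK : involutive (rlin nu).
Proof.
move=> y; rewrite /rlin dotBl dotZl nu1 mulr1 -addrA -opprD -scalerDl.
set c := (X in X *: nu); have -> : c = 0 by rewrite /c; ring.
by rewrite scale0r subr0.
Qed.

Lemma dot_rlin x y : dot (rlin nu x) (rlin nu y) = dot x y.
Proof.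
rewrite /rlin !(dotBl,dotBr,dotZl,dotZr) nu1 (dotC nu y); ring.
Qed.

Lemma enorm_rlin x : enorm (rlin nu x) = enorm x.
Proof. by rewrite /enorm dot_rlin. Qed.

Lemma reflK x0 lam : involutive (refl x0 nu lam).
Proof.
move=> y; rewrite !refl_rlin rlinD rlinK rlinZ [rlin nu nu]/rlin nu1 mulr1.
rewrite -[X in X - 2 *: _]scale1r -scalerBl scalerA addrA -scalerDl.
set c := (X in X *: nu); have -> : c = 0 by rewrite /c; ring.
by rewrite scale0r add0r.
Qed.

Lemma refl_sub x0 lam x y : refl x0 nu lam x - refl x0 nu lam y = rlin nu (x - y).
Proof.
by rewrite !refl_rlin opprD addrACA subrr add0r rlinD -[- y]scaleN1r rlinZ scaleN1r.
Qed.

Lemma enorm_refl x0 lam x y :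
  enorm (refl x0 nu lam x - refl x0 nu lam y) = enorm (x - y).
Proof. by rewrite refl_sub enorm_rlin. Qed.

Lemma dot_refl x0 lam y :
  dot (refl x0 nu lam y - x0) nu = 2 * lam - dot (y - x0) nu.
Proof. by rewrite /refl !(dotBl, dotDl, dotZl) nu1; ring. Qed.

End unit.

Lemma continuous_rlin nu : continuous (rlin nu).
Proof.
move=> y; apply: (@cvgB _ _ _ (nbhs y) _ id (fun y => (2 * dot y nu) *: nu)).
  exact: (@cvg_id _ (nbhs y)).
apply: (@cvgZr_tmp _ _ _ (nbhs y) _ (fun y => 2 * dot y nu)).
by apply: cvgM; [exact: cvg_cst|exact: continuous_dotr].
Qed.

Lemma continuous_refl x0 nu lam : continuous (refl x0 nu lam).
Proof.
rewrite (_ : refl _ _ _ = fun y => (2 * (lam + dot x0 nu)) *: nu + rlin nu y); last first.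
  by apply/funext => y; rewrite refl_rlin.
move=> y; apply: (@cvgD _ _ _ (nbhs y) _ (fun=> _) (rlin nu)).
  exact: cvg_cst.
exact: continuous_rlin.
Qed.

End reflection.

(** * Invariance of the integral under reflections *)

Section integral_reflection.
Context {R : realType} {n : nat}.
Local Notation RT := (measurableTypeR R).
Local Notation T := (n.-tuple RT).
Local Notation mu := (lebesgue_tuple n : {measure set T -> \bar R}).

(** An alias that carries the proof of sigma-finiteness, so that the structure asked by
    [shift_invariant_swap] can be attached to a given measure. *)
Definition with_sigma_finite (m : {measure set T -> \bar R})
  & sigma_finite [set: T] m : set T -> \bar R := m.

HB.instance Definition _ m sf :=
  Measure.copy (@with_sigma_finite m sf) (Measure.sort m).

HB.instance Definition _ m sf :=
  Measure_isSigmaFinite.Build _ _ _ (@with_sigma_finite m sf) sf.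

Lemma measurable_totuple d (S : measurableType d) (f : S -> 'rV[R]_n) :
  (forall i, measurable_fun [set: S] (fun x => f x 0 i : RT)) ->
  measurable_fun [set: S] (fun x => totuple (f x) : T).
Proof.
move=> mf; apply/measurable_fun_tnthP => i.
rewrite (_ : _ \o _ = fun x => f x 0 i : RT); first exact: mf.
by apply/funext => x /=; rewrite tnth_mktuple.
Qed.

Lemma measurable_totuple_continuous (f : 'rV[R]_n -> 'rV[R]_n) : continuous f ->
  measurable_fun [set: T] (fun t => totuple (f (torow t)) : T).
Proof.
move=> cf; apply: measurable_totuple => i.
apply: (@measurable_torow_continuous _ _ (fun x => f x 0 i)) => x.
by apply: (@continuous_comp _ _ _ f (fun y : 'rV[R]_n => y 0 i)); [exact: cf|exact: coord_continuous].
Qed.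

(** [ball] refers to the sup norm, hence is a cube of side 2 r; no volume of a Euclidean ball is
    ever computed. *)
Lemma lebesgue_tuple_ball (q : 'rV[R]_n) (r : R) : 0 < r ->
  mu (torow @^-1` ball q r) = ((2 * r) ^+ n)%:E.
Proof.
move=> r0; rewrite ball_coordE//.
rewrite (_ : _ @^-1` _ = box (fun i => `]q 0 i - r, q 0 i + r[%classic)); last first.
  by apply/seteqP; split=> t /= h i; have := h i; rewrite /= in_itv/= ltr_distl mxE.
rewrite lebesgue_tuple_box; last by move=> i; exact: measurable_itv.
rewrite (eq_bigr (fun=> (2 * r)%:E)); last first.
  move=> i _; rewrite lebesgue_measure_itv/= lte_fin ltrD2l gtrN//.
  by rewrite -EFinD; congr EFin; ring.
elim: n => [|k IH] in q *; first by rewrite big_ord0 expr0.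
by rewrite big_ord_recl IH ?exprS//; exact: 0.
Qed.

Variable nu : 'rV[R]_n.
Hypothesis nu1 : dot nu nu = 1.

Let L (t : T) : T := totuple (rlin nu (torow t)).

Let mL : measurable_fun setT L.
Proof. by apply: measurable_totuple_continuous; exact: continuous_rlin. Qed.

(** Euclidean balls, because [rlin] preserves these but not the cubes. *)
Let eball (k : R) : set T := [set t | enorm (torow t) < k].

Let measurable_eball k : measurable (eball k).
Proof.
rewrite (_ : eball k = torow @^-1` (enorm @^-1` `]-oo, k[%classic)).
  apply: measurable_torow_open.
  by move/continuousP : (@continuous_enorm R n); apply; exact: interval_open.
by apply/seteqP; split=> t; rewrite /= in_itv.
Qed.

Let eball_sub (k : nat) : eball k%:R `<=` cube k.
Proof.
move=> t /= tk i /=; rewrite in_itv/= -ler_norml.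
have := coord_le_enorm (torow t) i; rewrite mxE => /le_trans; apply.
exact: ltW.
Qed.

Let eball_lty (k : nat) : (mu (eball k%:R) < +oo)%E.
Proof.
apply: le_lt_trans (lebesgue_tuple_cube_lty k); apply: le_measure => //.
- by rewrite inE; exact: measurable_eball.
- by rewrite inE; exact: measurable_cube.
Qed.

Let eball_cover : \bigcup_(k : nat) eball k%:R = setT.
Proof.
apply/seteqP; split=> // t _; exists (Num.truncn (enorm (torow t))).+1 => //.
exact: truncnS_gt.
Qed.

Let eball1_gt0 : (0 < mu (eball 1))%E.
Proof.
(* The cube of half-side 1 / (n + 1) fits into the Euclidean unit ball, since [enorm] is at most n
   times the sup norm. *)
pose c : R := (n.+1%:R)^-1.
have c0 : 0 < c by rewrite invr_gt0.
apply: (@lt_le_trans _ _ (((2 * c) ^+ n)%:E)).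
  by rewrite lte_fin exprn_gt0// mulr_gt0.
rewrite -(lebesgue_tuple_ball 0 c0); apply: le_measure.
- by rewrite inE; apply: measurable_torow_open; exact: ball_open.
- by rewrite inE; exact: measurable_eball.
- move=> t; rewrite /= -ball_normE /= sub0r normrN => h.
  apply: le_lt_trans (enorm_le_norm _) _.
  apply: (@le_lt_trans _ _ (n%:R * c)); first by rewrite ler_wpM2l// ltW.
  by rewrite ltr_pdivrMr ?ltr0n// mul1r ltr_nat.
Qed.

Let invariant_mu : shift_invariant mu.
Proof. by move=> s A; exact: lebesgue_tuple_shift. Qed.

(** [L] is linear and involutive, so it turns the translation by s into the translation by L s. *)
Let invariant_L : shift_invariant (pushmeasure mL mu).
Proof.
move=> s A mA; change (mu (L @^-1` (tadd s @^-1` A)) = mu (L @^-1` A)).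
rewrite -[RHS](@lebesgue_tuple_shift _ _ (L s)); last exact: measurable_preimage.
congr (mu _); apply/funext => t; rewrite /preimage /=; congr (A _).
by apply: (can_inj torowK); rewrite /L !(torow_tadd, totupleK) rlinD rlinK.
Qed.

(* [shift_invariant_swap] for the unit ball, which [L] and [topp] preserve. *)
Lemma lebesgue_tuple_rlin A : measurable A -> mu (L @^-1` A) = mu A.
Proof.
move=> mA.
have sf1 : sigma_finite [set: T] mu.
  exists (fun k => eball k%:R); first by rewrite eball_cover.
  by move=> k; split; [exact: measurable_eball|exact: eball_lty].
have eballL k : L @^-1` eball k = eball k.
  by apply/seteqP; split=> t; rewrite /eball/= /L totupleK enorm_rlin.
have eballN k : topp @^-1` eball k = eball k.
  by apply/seteqP; split=> t; rewrite /eball/= torow_topp enormN.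
have sf2 : sigma_finite [set: T] (pushmeasure mL mu).
  exists (fun k => eball k%:R); first by rewrite eball_cover.
  move=> k; split; first exact: measurable_eball.
  by change (mu (L @^-1` eball k%:R) < +oo)%E; rewrite eballL; exact: eball_lty.
pose m1 : {sigma_finite_measure set T -> \bar R} := with_sigma_finite sf1.
pose m2 : {sigma_finite_measure set T -> \bar R} := with_sigma_finite sf2.
have := @shift_invariant_swap _ _ m1 m2 _ _ invariant_mu invariant_L (measurable_eball 1) mA.
change (mu (eball 1) * mu (L @^-1` A) =
  mu A * mu (L @^-1` (topp @^-1` eball 1)) -> mu (L @^-1` A) = mu A)%E.
rewrite eballN eballL muleC => h.
have fin1 : mu (eball 1) \is a fin_num by rewrite ge0_fin_numE//; exact: (eball_lty 1).
have h1 : (mu (L @^-1` A) <= mu A)%E by rewrite -(lee_pmul2r fin1 eball1_gt0) h.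
have h2 : (mu A <= mu (L @^-1` A))%E by rewrite -(lee_pmul2r fin1 eball1_gt0) h.
by apply/eqP; rewrite eq_le h1 h2.
Qed.

Variables (x0 : 'rV[R]_n) (lam : R).

Lemma lebesgue_tuple_refl A : measurable A ->
  mu ((fun t => totuple (refl x0 nu lam (torow t))) @^-1` A) = mu A.
Proof.
move=> mA.
pose b : T := totuple ((2 * (lam + dot x0 nu)) *: nu).
rewrite -[RHS](@lebesgue_tuple_shift _ _ b)// -[RHS]lebesgue_tuple_rlin; last first.
  by apply: measurable_preimage => //; exact: measurable_taddl.
congr (mu _); apply/funext => t; rewrite /preimage /=; congr (A _).
by apply: (can_inj torowK); rewrite /L /b !(torow_tadd, totupleK) refl_rlin.
Qed.

Definition Rn_integral (g : 'rV[R]_n -> R) : R := Rintegral mu setT (g \o torow).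

Definition Rn_integrable (g : 'rV[R]_n -> R) : Prop :=
  mu.-integrable setT (EFin \o (g \o torow)).

(** The change of variables [E] for nonnegative functions is applied to the absolute value for
    integrability, and to the positive and negative parts for the value. *)
Lemma Rn_integral_refl g : Rn_integrable g ->
  Rn_integrable (g \o refl x0 nu lam) /\
  Rn_integral (g \o refl x0 nu lam) = Rn_integral g.
Proof.
move=> ig.
pose f t : T := totuple (refl x0 nu lam (torow t)).
have mf : measurable_fun setT f.
  by apply: measurable_totuple_continuous; exact: continuous_refl.
have fK : involutive f by move=> t; rewrite /f totupleK reflK// torowK.
have gf : g \o refl x0 nu lam \o torow = g \o torow \o f.
  by apply/funext => t; rewrite /= totupleK.
have mg := measurable_int _ ig.
have E (h : T -> \bar R) : measurable_fun setT h -> (forall t, 0 <= h t)%E ->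
    (\int[mu]_x (h (f x)) = \int[mu]_x h x)%E.
  move=> mh h0.
  have := @ge0_integral_pushforward _ _ T T R f mf mu setT h measurableT mh (fun t _ => h0 t).
  rewrite preimage_setT /= => <-; apply: eq_measure_integral => B mB _.
  exact: lebesgue_tuple_refl.
have igf : Rn_integrable (g \o refl x0 nu lam).
  rewrite /Rn_integrable gf; apply/integrableP; split.
    by apply: (measurableT_comp mg mf).
  rewrite (E (fun t => `|(g (torow t))%:E|%E))//; last exact: measurableT_comp.
  by case/integrableP : ig.
split => //; rewrite /Rn_integral /Rintegral gf; congr fine.
rewrite [LHS]integralE [RHS]integralE; congr (_ - _)%E.
  rewrite -(E ((fun t => (g (torow t))%:E)^\+)%E)//.
    by apply: eq_integral => t _; rewrite !funeposE.
  exact: (measurable_funepos mg).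
rewrite -(E ((fun t => (g (torow t))%:E)^\-)%E)//.
  by apply: eq_integral => t _; rewrite !funenegE.
exact: (measurable_funeneg mg).
Qed.

End integral_reflection.

(** * Directional derivatives and the Laplacian at a minimum *)

Section directional.
Context {R : realType} {n : nat}.
Implicit Types (x y v : 'rV[R]_n) (f : 'rV[R]_n -> R) (U : set 'rV[R]_n).

Lemma is_derive_line f y v (s d : R) :
  is_derive (y + s *: v) v f d -> is_derive s 1 (fun t : R => f (y + t *: v)) d.
Proof.
move=> [df fd].
have E : (fun h : R => h^-1 *: 
    (((fun t : R => f (y + t *: v)) \o shift s) (h *: (1 : R^o)) - f (y + s *: v))) =
         (fun h : R => h^-1 *: ((f \o shift (y + s *: v)) (h *: v) - f (y + s *: v))).
  apply/funext => h /=; congr (_ *: (f _ - _)).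
  by rewrite [h *: _]mulr1 scalerDl addrCA.
split; first by rewrite /derivable E.
by rewrite /derive E.
Qed.

Lemma is_deriveP (f : R -> R) (x d : R) :
  is_derive x 1 f d <-> (h^-1 * (f (h + x) - f x)) @[h --> 0^'] --> d.
Proof.
have E : (fun h : R => h^-1 *: ((f \o shift x) (h *: (1 : R^o)) - f x)) =
         (fun h : R => h^-1 * (f (h + x) - f x)).
  by apply/funext => h /=; rewrite [h *: _]mulr1.
split=> [[df fd]|h].
  by move: df fd; rewrite /derivable /derive E => df <-.
have cv : cvg ((fun h : R => h^-1 * (f (h + x) - f x)) @ 0^').
  by apply/cvg_ex; exists d.
by split; rewrite ?/derivable ?/derive E//; apply/cvg_lim.
Qed.

(** The intermediate point is located by absolute values, so that one statement serves both signs of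
    [c]. *)
Lemma MVT_line f y v (c : R) :
  (forall s, `|s| <= `|c| -> derivable f (y + s *: v) v) ->
  exists2 s, `|s| <= `|c| & f (y + c *: v) - f y = c * 'D_v f (y + s *: v).
Proof.
move=> df.
have D (s : R) : `|s| <= `|c| -> 
    is_derive s (1 : R) (fun t : R => f (y + t *: v)) ('D_v f (y + s *: v)).
  by move=> /df ds; apply: is_derive_line; exact/derivableP.
have [c0|c0|c0] := ltgtP 0 c; last first.
- by exists 0; rewrite -c0 ?normr0// scale0r addr0 subrr mul0r.
- have [||s sI] := @MVT _ (fun t : R => f (y + t *: v)) (fun s => 'D_v f (y + s *: v)) c 0 c0.
  + move=> s; rewrite in_itv/= => /andP[cs s0]; apply: D.
    by rewrite !ltr0_norm// lerN2 ltW.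
  + apply: derivable_within_continuous => s; rewrite in_itv/= => /andP[cs s0].
    have [] // := D s _.
    by rewrite ler0_norm// ltr0_norm// lerN2.
  + rewrite scale0r addr0 sub0r mulrN => /eqP; rewrite -eqr_opp opprB opprK mulrC => /eqP ->.
    exists s => //; move: sI; rewrite in_itv/= => /andP[cs s0].
    by rewrite !ltr0_norm// lerN2 ltW.
- have [||s sI] := @MVT _ (fun t : R => f (y + t *: v)) (fun s => 'D_v f (y + s *: v)) 0 c c0.
  + move=> s; rewrite in_itv/= => /andP[cs s0]; apply: D.
    by rewrite !gtr0_norm// ltW.
  + apply: derivable_within_continuous => s; rewrite in_itv/= => /andP[cs s0].
    have [] // := D s _.
    by rewrite ger0_norm// gtr0_norm.
  + rewrite scale0r addr0 subr0 mulrC => ->.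
    exists s => //; move: sI; rewrite in_itv/= => /andP[cs s0].
    by rewrite !gtr0_norm// ltW.
Qed.

(** Continuous partial derivatives give every directional derivative: go from x to x + h v one
    coordinate at a time, [w k] keeping the first k coordinates of v, and apply the mean value
    theorem to each leg. *)
Lemma is_derive_dir f U x v : open U -> U x ->
  (forall i y, U y -> derivable f y (delta_mx 0 i)) ->
  (forall i, {for x, continuous (partial i f)}) ->
  is_derive x v f (\sum_(i < n) v 0 i * partial i f x).
Proof.
move=> oU Ux df cf.
have /nbhs_ballP[r /= r0 rU] : nbhs x U by exact: open_nbhs_nbhs.
pose w (k : nat) : 'rV[R]_n := \row_j (if (j < k)%N then v 0 j else 0).
have w0 : w 0%N = 0 by apply/rowP => j; rewrite !mxE.
have wn : w n = v by apply/rowP => j; rewrite !mxE ltn_ord.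
have wS (k : 'I_n) : w k.+1 = w k + v 0 k *: delta_mx 0 k.
  apply/rowP => j; rewrite !mxE eqxx /= ltnS leq_eqVlt val_eqE.
  case: (eqVneq j k) => [->|kj] /=; last by rewrite mulr0 addr0.
  by rewrite ltnn mulr1 add0r.
have wle (k : 'I_n) (s : R) : `|s| <= `|v 0 k| -> `|w k + s *: delta_mx 0 k| <= `|v|.
  move=> sv; apply: norm_le => // j; rewrite !mxE eqxx /= .
  case: ltnP => jk.
    rewrite (_ : (j == k) = false) ?mulr0 ?addr0 ?coord_le_norm//.
    by apply/eqP => jk'; rewrite jk' ltnn in jk.
  rewrite add0r; case: eqP => [_|_]; rewrite ?mulr1 ?mulr0 ?normr0//.
  by apply: le_trans sv _; exact: coord_le_norm.
have step (k : 'I_n) : (h^-1 * (f (x + h *: w k.+1) - f (x + h *: w k))) @[h --> 0^']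
    --> v 0 k * partial k f x.
  apply/cvgrPdist_lt => e e0.
  have : \forall y \near x, `|partial k f x - partial k f y| < e / (`|v 0 k| + 1).
    by move/cvgrPdist_lt : (cf k); apply; rewrite divr_gt0// ltr_wpDl.
  move=> /nbhs_ballP[r' /= r'0 Hr'].
  pose m : R := Num.min r r'.
  have m0 : 0 < m by rewrite lt_min r0.
  near=> h.
  have h0 : h != 0 by near: h; exact: nbhs_dnbhs_neq.
  have hr : `|h| * `|v| < m.
    have : `|h| < m / (`|v| + 1).
      by near: h; apply: dnbhs0_lt; rewrite divr_gt0// ltr_wpDl.
    rewrite ltr_pdivlMr ?ltr_wpDl// => /le_lt_trans; apply.
    by rewrite ler_wpM2l// lerDl.
  have inr (s : R) : `|s| <= `|h * v 0 k| ->
      `|x - (x + h *: w k + s *: delta_mx 0 k)| < m.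
    move=> sv; apply: le_lt_trans hr.
    rewrite -addrA opprD addNKr normrN.
    have -> : h *: w k + s *: delta_mx 0 k = h *: (w k + (s / h) *: delta_mx 0 k).
      by rewrite scalerDr scalerA mulrCA divff// mulr1.
    rewrite normrZ ler_wpM2l// wle// normrM normfV ler_pdivrMr ?normr_gt0//.
    by rewrite mulrC -normrM.
  have dl (s : R) : `|s| <= `|h * v 0 k| ->
      derivable f (x + h *: w k + s *: delta_mx 0 k) (delta_mx 0 k).
    move=> /inr; rewrite lt_min => /andP[sr _].
    by apply: df; apply: rU; rewrite -ball_normE.
  have [s sv E] := MVT_line dl.
  have -> : x + h *: w k.+1 = x + h *: w k + (h * v 0 k) *: delta_mx 0 k.
    by rewrite wS scalerDr scalerA addrA.
  rewrite E -mulrA mulKf// -mulrBr normrM.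
  have /inr := sv; rewrite lt_min => /andP[_ sr'].
  have {}Hr := Hr' _ ltac:(rewrite -ball_normE; exact: sr').
  apply: (@le_lt_trans _ _ (`|v 0 k| * (e / (`|v 0 k| + 1)))).
    by rewrite ler_wpM2l// ltW.
  by rewrite mulrCA gtr_pMr// ltr_pdivrMr ?ltr_wpDl// mul1r ltrDl.
have S : (\sum_(k < n) h^-1 * (f (x + h *: w k.+1) - f (x + h *: w k))) @[h --> 0^']
    --> \sum_(k < n) v 0 k * partial k f x.
  by apply: (@cvg_sum _ _ _ R R^o).
have E : (fun h : R => h^-1 *: ((f \o shift x) (h *: v) - f x)) =
  (fun h => \sum_(k < n) h^-1 * (f (x + h *: w k.+1) - f (x + h *: w k))).
  apply/funext => h; rewrite -mulr_sumr; congr (_ * _).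
  rewrite -(big_mkord xpredT (fun k => f (x + h *: w k.+1) - f (x + h *: w k))).
  rewrite telescope_sumr// wn w0 scaler0 addr0 /=; congr (f _ - _); exact: addrC.
have cv : cvg ((fun h : R => h^-1 *: ((f \o shift x) (h *: v) - f x)) @ 0^').
  by rewrite E; apply/cvg_ex; exists (\sum_(k < n) v 0 k * partial k f x).
by split; rewrite ?/derivable ?/derive// E; exact/cvg_lim.
Unshelve. all: by end_near.
Qed.

End directional.

(** [g1] vanishes at the minimum 0. If [g2] were negative, [g1] would be negative just to the right
    of 0, and the mean value theorem would make [g] drop below its minimum. *)
Lemma second_derivative_at_min {R : realType} (g g1 : R -> R) (g2 e : R) :
  0 < e -> (forall t, `|t| < e -> is_derive t (1 : R) g (g1 t)) ->
  is_derive (0 : R) (1 : R) g1 g2 ->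
  (forall t, `|t| < e -> g 0 <= g t) -> 0 <= g2.
Proof.
move=> e0 dg dg1 gmin.
have g10 : g1 0 = 0.
  have I t : t \in `](- e), e[%R -> `|t| < e by rewrite in_itv/= ltr_norml.
  have d0 : is_derive (0 : R) 1 g 0.
    apply: (@derive1_at_min _ g (- e) e 0).
    - by rewrite ge0_cp// ltW.
    - by move=> t /I /dg[].
    - by rewrite in_itv/= oppr_lt0 e0.
    - by move=> t /I; exact: gmin.
  have d1 := dg 0 ltac:(by rewrite normr0).
  by have := @derive_val _ _ _ _ _ _ _ d1; rewrite (@derive_val _ _ _ _ _ _ _ d0).
rewrite leNgt; apply/negP => g20.
have /is_deriveP := dg1.
move=> /cvgrPdist_lt /(_ (- g2)); rewrite oppr_gt0 => /(_ g20).
move=> /nbhs_ballP[r /= r0 Hr].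
pose c := Num.min r e / 2.
have m0 : 0 < Num.min r e by rewrite lt_min r0.
have c0 : 0 < c by rewrite divr_gt0.
have cm : c < Num.min r e by rewrite ltr_pdivrMr// ltr_pMr// ltr1n.
move: cm; rewrite lt_min => /andP[cr ce].
have g1neg t : 0 < t <= c -> g1 t < 0.
  move=> /andP[t0 tc].
  have := Hr t; rewrite -ball_normE /= sub0r normrN gtr0_norm//.
  move=> /(_ (le_lt_trans tc cr)) /(_ (lt0r_neq0 t0)).
  rewrite addr0 g10 subr0 distrC => /(le_lt_trans (ler_norm _)).
  by rewrite ltrBlDr addNr pmulr_rlt0// invr_gt0.
have [||s sI E] := @MVT R g g1 0 c c0.
- move=> s; rewrite in_itv/= => /andP[s0 sc]; apply: dg.
  by rewrite gtr0_norm// (lt_trans sc).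
- apply: derivable_within_continuous => s; rewrite in_itv/= => /andP[s0 sc].
  have [] // := dg s _.
  by rewrite ger0_norm// (le_lt_trans sc).
have : g 0 <= g c by apply: gmin; rewrite gtr0_norm.
rewrite -subr_ge0 E subr0 leNgt pmulr_llt0// g1neg//.
by move: sI; rewrite in_itv/= => /andP[-> /ltW].
Qed.

(** For a quadratic polynomial the hypothesis is an identity that [ring] settles. *)
Lemma is_derive_quotient {R : realType} (f : R -> R) (x a b : R) :
  (forall h, f (h + x) - f x = h * (a + h * b)) -> is_derive x (1 : R) f a.
Proof.
move=> fab; apply/is_deriveP.
have : (a + h * b) @[h --> 0^'] --> a + 0 * b.
  apply: cvg_within_filter; apply: (@cvgD _ R^o _ (nbhs (0 : R)) _ (fun=> a)).
    exact: cvg_cst.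
  by apply: cvgMr_tmp; exact: (@cvg_id _ (nbhs (0 : R))).
rewrite mul0r addr0; apply: cvg_trans; apply: near_eq_cvg.
near=> h; rewrite fab mulKf//; near: h; exact: nbhs_dnbhs_neq.
Unshelve. all: by end_near.
Qed.

Section laplacian.
Context {R : realType} {n : nat}.
Implicit Types (x y v : 'rV[R]_n) (f u : 'rV[R]_n -> R) (U : set 'rV[R]_n).

Definition hess_form u x v : R :=
  \sum_(j < n) v 0 j * (\sum_(k < n) v 0 k * partial k (partial j u) x).

Lemma C2_line u U x v : open U -> C_open 2 U u -> U x ->
  exists2 e : R, 0 < e &
    (forall t, `|t| < e -> is_derive t (1 : R) (fun t : R => u (x + t *: v))
      (\sum_(j < n) v 0 j * partial j u (x + t *: v))) /\
    is_derive (0 : R) (1 : R)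
      (fun t : R => \sum_(j < n) v 0 j * partial j u (x + t *: v))
      (hess_form u x v).
Proof.
move=> oU [du cu] Ux.
have near0 : \forall t \near (0 : R), U (x + t *: v).
  have cl : continuous (fun t : R => x + t *: v).
    move=> t; apply: (@cvgD _ _ _ (nbhs t) _ (fun=> x) (fun t => t *: v)).
      exact: cvg_cst.
    apply: (@cvgZr_tmp _ _ _ (nbhs t)); exact: (@cvg_id _ (nbhs t)).
  by apply: (cl 0); rewrite scale0r addr0; exact: open_nbhs_nbhs.
have [e /= e0 He] := near0.
exists e => //; split.
  move=> t te; apply: is_derive_line.
  have Ut : U (x + t *: v) by apply: He; rewrite /= sub0r normrN.
  apply: (is_derive_dir v oU Ut) => [i y Uy|i]; first exact: (du [::]).
  exact: (cu [:: i]).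
have -> : (fun t : R => \sum_(j < n) v 0 j * partial j u (x + t *: v)) =
    \sum_(j < n) (fun t : R => v 0 j * partial j u (x + t *: v)).
  by apply/funext => t; rewrite fct_sumE.
apply: is_derive_sum => j.
apply: (@is_deriveZ _ _ R (fun t : R => partial j u (x + t *: v))).
apply: is_derive_line; rewrite scale0r addr0.
apply: (is_derive_dir v oU Ux) => [i y Uy|i]; first exact: (du [:: j]).
exact: (cu [:: i; j]).
Qed.

Lemma sum_delta (i : 'I_n) (F : 'I_n -> R) :
  \sum_(j < n) (delta_mx 0 i : 'rV[R]_n) 0 j * F j = F i.
Proof.
rewrite (bigD1 i) //= big1; first by rewrite addr0 mxE !eqxx mul1r.
by move=> j ji; rewrite mxE eqxx/= (negbTE ji) mul0r.
Qed.

Lemma hess_form_delta u x i : hess_form u x (delta_mx 0 i) = partial i (partial i u) x.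
Proof. by rewrite /hess_form sum_delta sum_delta. Qed.

Lemma dot_deltal (i : 'I_n) x : dot (delta_mx 0 i) x = x 0 i.
Proof. exact: (sum_delta i (x 0)). Qed.

Lemma dot_delta (i j : 'I_n) : dot (delta_mx 0 i) (delta_mx 0 j) = (i == j)%:R :> R.
Proof. by rewrite dot_deltal mxE eqxx. Qed.

(** The trace of the Hessian is the same in every orthonormal basis: the matrix [r] of the
    reflection is orthogonal, which is [orth]. *)
Lemma sum_hess_form_rlin u x nu : dot nu nu = 1 ->
  \sum_(i < n) hess_form u x (rlin nu (delta_mx 0 i)) = - neg_laplacian u x.
Proof.
move=> nu1; rewrite /neg_laplacian opprK.
pose r (i j : 'I_n) : R := (i == j)%:R - 2 * nu 0 i * nu 0 j.
have rE i j : rlin nu (delta_mx 0 i) 0 j = r i j.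
  rewrite /rlin /r !mxE eqxx /= eq_sym; congr (_ - 2 * _ * _).
  by rewrite dot_deltal.
have orth j k : \sum_(i < n) r i j * r i k = (j == k)%:R.
  rewrite -dot_delta -(dot_rlin nu1); apply: eq_bigr => i _.
  by rewrite !rE /r !(eq_sym i) -!mulrA !(mulrC (nu 0 i)).
transitivity (\sum_(j < n) \sum_(k < n)
    (\sum_(i < n) r i j * r i k) * partial k (partial j u) x).
  rewrite /hess_form exchange_big /=; apply: eq_bigr => j _.
  under [RHS]eq_bigr do rewrite mulr_suml.
  rewrite [RHS]exchange_big /=; apply: eq_bigr => i _.
  by rewrite mulr_sumr; apply: eq_bigr => k _; rewrite !rE mulrA.
apply: eq_bigr => j _; rewrite -[RHS](sum_delta j (fun k => partial k (partial j u) x)).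
by apply: eq_bigr => k _; rewrite orth mxE eqxx/= eq_sym.
Qed.

Lemma near_line x v (P : set 'rV[R]_n) : (\forall y \near x, P y) ->
  \forall t \near (0 : R), P (x + t *: v).
Proof.
move=> nP.
have cl : continuous (fun t : R => x + t *: v).
  move=> t; apply: (@cvgD _ _ _ (nbhs t) _ (fun=> x) (fun t => t *: v)).
    exact: cvg_cst.
  apply: (@cvgZr_tmp _ _ _ (nbhs t)); exact: (@cvg_id _ (nbhs t)).
by apply: (cl 0); rewrite scale0r addr0.
Qed.

Lemma neg_laplacian_at_min u U x : open U -> C_open 2 U u -> U x ->
  (\forall y \near x, u x <= u y) -> neg_laplacian u x <= 0.
Proof.
move=> oU cu Ux umin; rewrite oppr_le0; apply: sumr_ge0 => i _.
rewrite -hess_form_delta.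
have [e e0 [d1 d2]] := C2_line (delta_mx 0 i) oU cu Ux.
have [e' /= e'0 He] := near_line (delta_mx 0 i) umin.
apply: (@second_derivative_at_min _ _ _ _ (Num.min e e')) d2 _; first by rewrite lt_min e0.
  by move=> t; rewrite lt_min => /andP[te _]; exact: d1.
move=> t; rewrite lt_min => /andP[_ te]; rewrite scale0r addr0.
by apply: He; rewrite /= sub0r normrN.
Qed.

(* The parabola [A s^2] in the distance [s] to the plane of reflection serves
   as barrier; only [R R^T = 1] is used of the reflection [R], so the mixed
   partials need not commute. *)
Lemma neg_laplacian_refl_at_min u U x x0 nu (lam A : R) :
  dot nu nu = 1 -> open U -> C_open 2 U u -> U x -> U (refl x0 nu lam x) ->
  (\forall y \near x,
    u (refl x0 nu lam x) - u x - A * (lam - dot (x - x0) nu) ^+ 2 <=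
    u (refl x0 nu lam y) - u y - A * (lam - dot (y - x0) nu) ^+ 2) ->
  neg_laplacian u (refl x0 nu lam x) - neg_laplacian u x <= - (2 * A).
Proof.
move=> nu1 oU cu Ux Ux' gmin.
set x' := refl _ _ _ x in Ux' gmin *.
(* The second derivative along e_i of the function minimised; the reflected term moves along the
   reflected e_i. Summing over i gives the claim, since the squares of the coordinates of [nu] add
   up to 1. *)
suff H i : 0 <= hess_form u x' (rlin nu (delta_mx 0 i)) - hess_form u x (delta_mx 0 i)
    - 2 * A * nu 0 i ^+ 2.
  pose a i := hess_form u x' (rlin nu (delta_mx 0 i)).
  pose b i := hess_form u x (delta_mx 0 i).
  pose c i := 2 * A * nu 0 i ^+ 2.
  have Sa : \sum_(i < n) a i = - neg_laplacian u x' by exact: sum_hess_form_rlin.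
  have Sb : \sum_(i < n) b i = - neg_laplacian u x.
    by rewrite /neg_laplacian opprK; apply: eq_bigr => i _; exact: hess_form_delta.
  have Sc : \sum_(i < n) c i = 2 * A.
    transitivity (2 * A * dot nu nu); last by rewrite nu1 mulr1.
    by rewrite [dot nu nu]/dot mulr_sumr; apply: eq_bigr => i _; rewrite /c expr2.
  have Habc i : 0 <= a i - b i - c i := H i.
  move: (neg_laplacian u x') (neg_laplacian u x) a b c Sa Sb Sc Habc.
  move=> lx' lx a b c Sa Sb Sc Habc.
  have : 0 <= \sum_(i < n) (a i - b i - c i) by apply: sumr_ge0.
  have sumr3 (F G K : 'I_n -> R) : \sum_(i < n) (F i - G i - K i) =
      \sum_(i < n) F i - \sum_(i < n) G i - \sum_(i < n) K i.
    by rewrite -sumrB -sumrB.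
  by rewrite sumr3 Sa Sb Sc; lra.
set ei := delta_mx 0 i; set ri := rlin nu ei.
have [e e0 [d1 d2]] := C2_line ei oU cu Ux.
have [f f0 [k1 k2]] := C2_line ri oU cu Ux'.
have [e' /= e'0 He] := near_line ei gmin.
pose s0 := lam - dot (x - x0) nu.
have lineE t : lam - dot (x + t *: ei - x0) nu = s0 - t * nu 0 i.
  by rewrite /s0 !(dotBl, dotDl, dotZl) /ei dot_deltal; ring.
have reflE t : refl x0 nu lam (x + t *: ei) = x' + t *: ri.
  rewrite -[LHS](subrK x') [X in X + _]refl_sub addrC; congr (_ + _).
  by rewrite addrAC subrr add0r rlinZ.
move: (hess_form u x' ri) (hess_form u x ei) k2 d2 => a b k2 d2.
apply: (@second_derivative_at_min _
  (fun t : R => u (x' + t *: ri) - u (x + t *: ei) - A * (s0 - t * nu 0 i) ^+ 2)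
  (fun t => \sum_(j < n) ri 0 j * partial j u (x' + t *: ri) -
     \sum_(j < n) ei 0 j * partial j u (x + t *: ei)
     - (- (2 * A * nu 0 i) * (s0 - t * nu 0 i)))
  (a - b - 2 * A * nu 0 i ^+ 2) (Num.min e' (Num.min e f))).
- by rewrite !lt_min e'0 e0.
- move=> t; rewrite !lt_min => /and3P[_ te tf].
  apply: is_deriveB; first by apply: is_deriveB; [exact: k1|exact: d1].
  by apply: (@is_derive_quotient _ _ _ _ (A * nu 0 i ^+ 2)) => h; ring.
- apply: is_deriveB.
  by apply: (@is_derive_quotient _ _ _ (2 * A * nu 0 i ^+ 2) 0) => h; ring.
- move=> t; rewrite !lt_min => /and3P[te _ _].
  have := He t; rewrite /= sub0r normrN => /(_ te).
  by rewrite reflE lineE !scale0r !addr0 mul0r subr0.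
Qed.

End laplacian.

(** * Regularity of the iterated Laplacians *)

Section regularity.
Context {R : realType} {n : nat}.
Implicit Types (x y v : 'rV[R]_n) (f g u : 'rV[R]_n -> R) (U : set 'rV[R]_n).
Implicit Types (s : seq 'I_n).

Lemma near_quotient f g x v : (\forall y \near x, f y = g y) ->
  \forall h \near (0 : R)^', h^-1 *: ((g \o shift x) (h *: v) - g x) =
                             h^-1 *: ((f \o shift x) (h *: v) - f x).
Proof.
move=> fg; have fgx : f x = g x by exact: nbhs_singleton fg.
have := near_line v fg; move=> /(@nbhs_dnbhs _ (0 : R)); apply: filterS => h.
by rewrite /= addrC => ->; rewrite fgx.
Qed.

Lemma near_eq_derivable f g x v : (\forall y \near x, f y = g y) ->
  derivable f x v -> derivable g x v.
Proof.
move=> fg /cvg_ex[l fl]; apply/cvg_ex; exists l.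
by apply: cvg_trans fl; apply: near_eq_cvg; near do apply/esym; apply: near_quotient.
Unshelve. all: by end_near.
Qed.

Lemma near_eq_derive f g x v : (\forall y \near x, f y = g y) ->
  'D_v f x = 'D_v g x.
Proof.
(* [derive] chooses a limit of the quotient. Both quotients have the same limits, so the choices
   agree even where no derivative exists. *)
move=> fg; rewrite /derive; congr (get _); apply/funext => l; apply/propext.
split; apply: cvg_trans; apply: near_eq_cvg; last exact: near_quotient.
by apply: filterS (near_quotient v fg) => h ->.
Qed.

Lemma open_near_eq U f g x : open U -> U x -> (forall y, U y -> f y = g y) ->
  \forall y \near x, f y = g y.
Proof. by move=> oU Ux fg; apply: filterS fg _; exact: open_nbhs_nbhs. Qed.

Lemma partials_eq_on U f g : open U -> (forall x, U x -> f x = g x) ->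
  forall s x, U x -> partials s f x = partials s g x.
Proof.
move=> oU fg; elim=> [|i s IH] x Ux /=; first exact: fg.
by apply: near_eq_derive; exact: open_near_eq IH.
Qed.

Lemma C_open_eq_on k U f g : open U -> (forall x, U x -> f x = g x) ->
  C_open k U f -> C_open k U g.
Proof.
move=> oU fg [df cf]; split=> [s i x sk Ux|s x sk Ux].
  apply: near_eq_derivable (df s i x sk Ux).
  by apply: (open_near_eq oU Ux); exact: partials_eq_on.
have E := open_near_eq oU Ux (partials_eq_on oU fg s).
have h : partials s f @ x --> partials s f x := cf s x sk Ux.
rewrite /prop_for /continuous_at -(nbhs_singleton E); apply: cvg_trans h.
exact: (@near_eq_cvg _ _ (nbhs x) _ (partials s f) (partials s g) E).
Qed.

Lemma C_open_le k l U f : (k <= l)%N -> C_open l U f -> C_open k U f.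
Proof.
move=> kl [df cf]; split=> [s i x sk|s x sk]; first by apply: df; exact: leq_trans kl.
by apply: cf; exact: leq_trans kl.
Qed.

(** [partials] is a [foldr]: the derivatives of the Laplacian, taken first, stand at the end of the
    word. *)
Lemma partials_neg_laplacian k U u : open U -> C_open k.+2 U u ->
  forall s x, (size s <= k)%N -> U x ->
  partials s (neg_laplacian u) x = - \sum_(i < n) partials (s ++ [:: i; i]) u x.
Proof.
move=> oU [du _]; elim=> [//|j s IH] x sk Ux /=.
rewrite [LHS](near_eq_derive (g := fun y => - \sum_(i < n) partials (s ++ [:: i; i]) u y)); last first.
  by apply: (open_near_eq oU Ux) => y Uy; apply: IH => //; exact: ltnW.
have -> : (fun y => - \sum_(i < n) partials (s ++ [:: i; i]) u y) =
  - (\sum_(i < n) partials (s ++ [:: i; i]) u).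
  by apply/funext => y; rewrite fctE fct_sumE.
have D i : derivable (partials (s ++ [:: i; i]) u) x (delta_mx 0 j).
  by apply: du => //; rewrite size_cat addn2.
by rewrite deriveN ?derive_sum//; exact: derivable_sum.
Qed.

Lemma C_open_neg_laplacian k U u : open U -> C_open k.+2 U u ->
  C_open k U (neg_laplacian u).
Proof.
move=> oU Cu; have [du cu] := Cu.
pose F s := - (\sum_(i < n) partials (s ++ [:: i; i]) u).
have FE s x : (size s <= k)%N -> U x ->
    \forall y \near x, F s y = partials s (neg_laplacian u) y.
  move=> sk Ux; apply: (open_near_eq oU Ux) => y Uy.
  by rewrite (partials_neg_laplacian oU Cu)// /F fctE fct_sumE.
split=> [s i x sk Ux|s x sk Ux].
  apply: near_eq_derivable (FE s x (ltnW sk) Ux) _.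
  apply: derivableN; apply: derivable_sum => j.
  by apply: du => //; rewrite size_cat addn2.
have E := FE s x sk Ux; rewrite /prop_for /continuous_at -(nbhs_singleton E).
apply: (@cvg_trans _ (F s @ x)).
  exact: (@near_eq_cvg _ _ (nbhs x) _ (F s) (partials s (neg_laplacian u)) E).
rewrite /F /=.
have -> : (- (\sum_(i < n) partials (s ++ [:: i; i]) u)) =
  (fun y => - \sum_(i < n) partials (s ++ [:: i; i]) u y).
  by apply/funext => y; rewrite fctE fct_sumE.
apply: (@cvgN _ _ _ (nbhs x)); apply: (@cvg_sum _ (nbhs x) _ R R^o) => i _.
by apply: cu => //; rewrite size_cat addn2.
Qed.

(** The part of [C_closure] inherited by [neg_laplacian u]. The values of [neg_laplacian u] on the
    boundary itself are not controlled, so only an extension from [U] is asked for. *)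
Definition extends_to_closure (k : nat) U f : Prop :=
  forall s, (size s <= k)%N ->
    exists2 g : 'rV[R]_n -> R, {within closure U, continuous g} &
      forall x, U x -> g x = partials s f x.

Lemma extends_neg_laplacian k U u : open U -> C_open k.+2 U u ->
  extends_to_closure k.+2 U u -> extends_to_closure k U (neg_laplacian u).
Proof.
move=> oU Cu eu s sk.
have ex i : exists g : 'rV[R]_n -> R, {within closure U, continuous g} /\
    forall x, U x -> g x = partials (s ++ [:: i; i]) u x.
  have [|g cg gE] := eu (s ++ [:: i; i]); first by rewrite size_cat addn2.
  by exists g.
have [g gP] := boolp.choice ex.
exists (fun x => - \sum_(i < n) g i x).
  apply/subspace_continuousP => x Kx.
  apply: (@cvgN _ _ _ (within (closure U) (nbhs x))).
  apply: (@cvg_sum _ (within (closure U) (nbhs x)) _ R R^o) => i _.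
  by have [/subspace_continuousP cg _] := gP i; exact: cg.
move=> x Ux; rewrite (partials_neg_laplacian oU Cu)//; congr (- _).
by apply: eq_bigr => i _; have [_ ->] := gP i.
Qed.

Lemma iter_neg_laplacian k i U u : open U -> C_open (k + i.*2) U u ->
  extends_to_closure (k + i.*2) U u ->
  C_open k U (iter i neg_laplacian u) /\
  extends_to_closure k U (iter i neg_laplacian u).
Proof.
move=> oU; elim: i k => [|i IH] k; first by rewrite addn0.
rewrite doubleS !addnS => Cu eu.
have [C1 E1] := IH k.+2 ltac:(by rewrite !addSn) ltac:(by rewrite !addSn).
by split; [exact: C_open_neg_laplacian|exact: extends_neg_laplacian].
Qed.

End regularity.

(** * Continuity on the whole space under the Navier conditions *)

Section navier.
Context {R : realType} {n : nat}.
Variables (Omega : set 'rV[R]_n) (u : 'rV[R]_n -> R).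
Hypotheses (nodd : odd n) (oO : open Omega) (Cu : C_closure n.-1 Omega u)
  (nav : navier_exterior Omega u).
Implicit Types (x y : 'rV[R]_n).
Local Notation m := n.-1./2.

Let doublem : m.*2 = n.-1.
Proof. by have := odd_double_half n.-1; case: n nodd => //= k /negbTE ->. Qed.

Let Cu_order k i : (k + i.*2 <= n.-1)%N ->
  C_open k Omega (iter i neg_laplacian u) /\
  extends_to_closure k Omega (iter i neg_laplacian u).
Proof.
have [Co _ Ce] := Cu; move=> ki; apply: iter_neg_laplacian => //.
  exact: C_open_le ki Co.
by move=> s sk; apply: Ce; exact: leq_trans ki.
Qed.

Lemma neg_laplacian_iter_in i x : Omega x ->
  neg_laplacian_iter Omega i u x = iter i neg_laplacian u x.
Proof.
move=> Ox; rewrite /neg_laplacian_iter /boundary_extension ifF//.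
apply/negbTE; rewrite notin_setE => -[_]; apply.
by move/interior_id : oO => ->.
Qed.

(** On the closure the function is the continuous extension [g], since [boundary_extension] takes
    the limit from inside. Near a boundary point, points of Omega are compared through [g], and all
    others share with that point the value 0. *)
Lemma neg_laplacian_iter_continuous i : (i <= m)%N ->
  continuous (neg_laplacian_iter Omega i u).
Proof.
move=> im.
have [_ /(_ [::])] : _ /\ _ := @Cu_order 0 i ltac:(by rewrite add0n -doublem leq_double).
move=> /(_ isT)[g /subspace_continuousP cg gE].
have oOi := oO; move/interior_id in oOi.
have WE y : closure Omega y -> neg_laplacian_iter Omega i u y = g y.
  move=> cy; have [Oy|Oy] := pselect (Omega y); first by rewrite neg_laplacian_iter_in// gE.
  rewrite /neg_laplacian_iter /boundary_extension ifT; last first.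
    by rewrite inE; split => //; rewrite oOi.
  have PF : ProperFilter (within Omega (nbhs y)) by exact: within_nbhs_proper.
  apply: cvg_lim => //.
  apply: (@cvg_trans _ (g y0 @[y0 --> within Omega (nbhs y)])).
    apply: near_eq_cvg; near=> z; rewrite gE//=; near: z; exact: withinT.
  apply: cvg_trans (cg y cy); apply: cvg_app; apply: within_subset.
  exact: subset_closure.
suff cW (x : 'rV[R]_n) : neg_laplacian_iter Omega i u y @[y --> nbhs x] -->
    neg_laplacian_iter Omega i u x by move=> x; exact: cW.
apply/cvgrPdist_lt => e e0.
have [cx|cx] := pselect (closure Omega x); last first.
  have : \forall y \near x, ~ closure Omega y.
    by apply: open_nbhs_nbhs; split => //; exact/closed_openC/closed_closure.
  apply: filterS => y cy; rewrite !nav ?subrr ?normr0//.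
    by move=> /(@subset_closure _ Omega).
  by move=> /(@subset_closure _ Omega).
have : \forall y \near x, closure Omega y -> `|g x - g y| < e.
  by move/cvgrPdist_lt : (cg x cx) => /(_ _ e0).
have [Ox|Ox] := pselect (Omega x).
  have : \forall y \near x, Omega y by exact: open_nbhs_nbhs.
  apply: filterS2 => y Oy /(_ (subset_closure Oy)).
  by rewrite !WE//; exact: subset_closure.
apply: filterS => y; have [Oy /(_ (subset_closure Oy))|Oy _] := pselect (Omega y).
  by rewrite !WE//; exact: subset_closure.
by rewrite !nav// subrr normr0.
Unshelve. all: by end_near.
Qed.

Lemma neg_laplacian_iter_C2 i : (i < m)%N ->
  C_open 2 Omega (neg_laplacian_iter Omega i u) /\
  forall x, Omega x -> neg_laplacian (neg_laplacian_iter Omega i u) x =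
                       neg_laplacian_iter Omega i.+1 u x.
Proof.
move=> im.
(* Two derivatives of the i-th iterate cost 2 (i + 1) <= 2 m = n - 1 derivatives of u. *)
have [Ci _] := @Cu_order 2 i ltac:(by rewrite -doublem -[2%N]/(1.*2) -doubleD leq_double).
have E x : Omega x -> iter i neg_laplacian u x = neg_laplacian_iter Omega i u x.
  by move=> Ox; rewrite neg_laplacian_iter_in.
split; first exact: C_open_eq_on E Ci.
move=> x Ox; rewrite [RHS](neg_laplacian_iter_in i.+1 Ox) iterS.
have := partials_eq_on oO E; move: (iter i _ _) (neg_laplacian_iter _ _ _) => f g fg.
rewrite /neg_laplacian; apply: (congr1 -%R); apply: eq_bigr => j _.
by apply/esym; exact: (fg [:: j; j] x Ox).
Qed.

End navier.

(** * The fractional Laplacian and reflections *)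

Section truncated_integrals.
Context {R : realType} {n : nat}.
Local Notation RT := (measurableTypeR R).
Local Notation T := (n.-tuple RT).
Local Notation mu := (lebesgue_tuple n : {measure set T -> \bar R}).
Implicit Types (x y q : 'rV[R]_n) (v g : 'rV[R]_n -> R).

(** The exponent n + 2 sigma stays unsimplified at sigma = 1/2, to match [frac_laplacian]. *)
Definition riesz_kernel x y : R := (enorm (x - y) `^ (n%:R + 2 * 2^-1))^-1.

(** The integrand is extended by 0, so that reflections act on integrals over the whole space. *)
Definition truncated v x (delta : R) y : R :=
  if delta <= enorm (x - y) then (v x - v y) * riesz_kernel x y else 0.

(** If the positive or the negative part has infinite integral, so does the difference, even when
    both do, and [fine] sends it to 0. *)
Lemma measurable_fun_Rintegral_neq0 (f : T -> R) : measurable_fun setT f ->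
  Rintegral mu setT f != 0 -> mu.-integrable setT (EFin \o f).
Proof.
move=> mf; rewrite /Rintegral integralE => I0.
have mE : measurable_fun setT (EFin \o f) by exact/measurable_EFinP.
have Ip : (0 <= \int[mu]_x (EFin \o f)^\+ x)%E by exact: integral_ge0.
have In : (0 <= \int[mu]_x (EFin \o f)^\- x)%E by exact: integral_ge0.
apply/integrableP; split => //.
have -> : (fun t => `|(EFin \o f) t|%E) =
    (fun t => (EFin \o f)^\+ t + (EFin \o f)^\- t)%E.
  exact: (fune_abse (EFin \o f)).
rewrite ge0_integralD//; [|exact: measurable_funepos|exact: measurable_funeneg].
move: I0 Ip In; set a := (\int[_]_x _)%E; set b := (\int[_]_x _)%E.
by move: a b => [a| |] [b| |] //=; rewrite ?eqxx// -EFinD ltry.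
Qed.

Lemma measurable_enorm_sub x :
  measurable_fun setT (fun t : T => enorm (x - torow t)).
Proof.
apply: (@measurable_torow_continuous _ _ (fun y => enorm (x - y))) => y.
apply: (@continuous_comp _ _ _ (fun y => x - y) (@enorm R n)); last exact: continuous_enorm.
apply: (@cvgB _ _ _ (nbhs y) _ (fun=> x) id); first exact: cvg_cst.
exact: (@cvg_id _ (nbhs y)).
Qed.

Lemma measurable_truncated v x delta : continuous v ->
  measurable_fun setT (truncated v x delta \o torow).
Proof.
move=> cv.
have me := measurable_enorm_sub x.
rewrite (_ : _ \o _ = fun t => (if delta <= enorm (x - torow t)
  then (v x - v (torow t)) * (enorm (x - torow t) `^ (- (n%:R + 2 * 2^-1))) else 0)); last first.
  by apply/funext => t; rewrite /= /truncated /riesz_kernel powRN.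
apply: measurable_fun_ifT => //.
  by apply: measurable_fun_ler.
apply: measurable_funM.
  apply: measurable_funB => //; exact: measurable_torow_continuous.
exact: (measurableT_comp (measurable_powR _) me).
Qed.

Lemma integralRn_truncated v x (delta : R) :
  integralRn [set y | delta <= enorm (x - y)]
    (fun y => (v x - v y) / enorm (x - y) `^ (n%:R + 2 * 2^-1)) =
  Rn_integral (truncated v x delta).
Proof.
rewrite /integralRn Rintegral_mkcond; congr (Rintegral _ _ _); apply/funext => t.
rewrite /= patchE /truncated; case: ifPn => /=.
  by rewrite in_setE /= => ->.
by rewrite notin_setE /= => /negP/negbTE ->.
Qed.

Lemma frac_const_ge0 (sigma : R) : 0 <= sigma -> 0 <= @frac_const R n sigma.
Proof.
have G0 (s : R) : 0 <= Gamma s.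
  by apply: Rintegral_ge0 => t _; rewrite mulr_ge0// ?powR_ge0// expR_ge0.
by move=> s0; rewrite /frac_const divr_ge0 ?mulr_ge0// ?powR_ge0.
Qed.

Lemma frac_laplacian_gt0 v x : 0 < frac_laplacian 2^-1 v x ->
  0 < @frac_const R n 2^-1 /\
  exists2 L : R, Rn_integral (truncated v x delta) @[delta --> 0^'+] --> L &
    frac_laplacian 2^-1 v x = @frac_const R n 2^-1 * L /\ 0 < L.
Proof.
rewrite /frac_laplacian.
rewrite (funext (integralRn_truncated v x)).
set C := frac_const _; have C0 : 0 <= C by apply: frac_const_ge0; rewrite invr_ge0.
set F := (X in lim X) => CL; rewrite -/F.
have {}C0 : 0 < C.
  rewrite lt_neqAle C0 andbT eq_sym.
  by apply: contraTneq CL => ->; rewrite mul0r ltxx.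
split=> //.
have cF : cvg F.
  apply: contrapT => /dvgP dF; move: CL; rewrite dF.
  by rewrite (_ : point = 0 :> R)// mulr0 ltxx.
exists (lim F) => //; split => //.
by rewrite -(pmulr_rgt0 _ C0).
Qed.

(** Close to the limit L > 0 the truncated integrals are nonzero, which forces integrability. *)
Lemma truncated_integrable v x (L : R) : continuous v -> 0 < L ->
  Rn_integral (truncated v x delta) @[delta --> 0^'+] --> L ->
  \forall delta \near 0^'+, Rn_integrable (truncated v x delta).
Proof.
move=> cv L0 /cvgrPdist_lt /(_ _ L0); apply: filterS => delta /= h.
apply: measurable_fun_Rintegral_neq0; first exact: measurable_truncated.
apply: contraTneq h => E.
by rewrite /Rn_integral E subr0 gtr0_norm// ltxx.
Qed.

Lemma indic_torow (B : set 'rV[R]_n) :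
  (\1_B : 'rV[R]_n -> R) \o torow = \1_(torow @^-1` B : set T).
Proof.
apply/funext => t; rewrite /= !indicE.
by have -> : (t \in torow @^-1` B) = (torow t \in B) by apply/idP/idP; rewrite !in_setE.
Qed.

Lemma Rn_indic_ball q r : 0 < r ->
  Rn_integrable (\1_(ball q r) : 'rV[R]_n -> R) /\
  Rn_integral (\1_(ball q r)) = (2 * r) ^+ n.
Proof.
move=> r0.
have mB : measurable (torow @^-1` ball q r : set T).
  by apply: measurable_torow_open; exact: ball_open.
have E : (\1_(ball q r) : 'rV[R]_n -> R) \o torow = \1_(torow @^-1` ball q r : set T).
  exact: indic_torow.
split; rewrite /Rn_integrable /Rn_integral ?/Rintegral E.
  apply/integrableP; split; first by apply/measurable_EFinP; exact: measurable_indic.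
  rewrite (eq_integral (fun t => (\1_(torow @^-1` ball q r) t)%:E)); last first.
    by move=> t _; rewrite /= ger0_norm.
  by rewrite integral_indic// setIT lebesgue_tuple_ball// ltry.
by rewrite integral_indic// setIT lebesgue_tuple_ball.
Qed.

End truncated_integrals.

Section Rn_integral_linear.
Context {R : realType} {n : nat}.
Implicit Types (f g : 'rV[R]_n -> R).

Lemma Rn_integralD f g : Rn_integrable f -> Rn_integrable g ->
  Rn_integrable (fun y => f y + g y) /\
  Rn_integral (fun y => f y + g y) = Rn_integral f + Rn_integral g.
Proof.
move=> fi gi; split; last exact: RintegralD.
rewrite /Rn_integrable (_ : _ \o _ = (EFin \o (f \o torow)) \+ (EFin \o (g \o torow)))%E//.
exact: integrableD.
Qed.

Lemma Rn_integralZ c f : Rn_integrable f ->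
  Rn_integrable (fun y => c * f y) /\
  Rn_integral (fun y => c * f y) = c * Rn_integral f.
Proof.
move=> fi; split; last exact: RintegralZl.
rewrite /Rn_integrable (_ : _ \o _ = (fun t => c%:E * (EFin \o (f \o torow)) t)%E)//.
exact: integrableZl.
Qed.

Lemma Rn_integralB f g : Rn_integrable f -> Rn_integrable g ->
  Rn_integrable (fun y => f y - g y) /\
  Rn_integral (fun y => f y - g y) = Rn_integral f - Rn_integral g.
Proof.
move=> fi gi; have [g'i g'E] := Rn_integralZ (-1) gi.
have [hi hE] := Rn_integralD fi g'i.
rewrite g'E mulN1r in hE; rewrite -hE.
rewrite (_ : (fun y => f y - g y) = (fun y => f y + -1 * g y))//.
by apply/funext => y; rewrite mulN1r.
Qed.

Lemma le_Rn_integral f g : Rn_integrable f -> Rn_integrable g ->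
  (forall y, f y <= g y) -> Rn_integral f <= Rn_integral g.
Proof. by move=> fi gi fg; apply: le_Rintegral => // t _; exact: fg. Qed.

End Rn_integral_linear.

(** Contribution of a pair of mirror points: a = w x is the minimum, b = w y, and k, k' are the
    kernels at y and at its mirror image, where antisymmetry gives w the value - b. *)
Lemma folded_kernel_le0 {R : realType} (a b k k' : R) :
  a <= 0 -> a <= b -> 0 <= k' -> k' <= k -> (a - b) * k + (a + b) * k' <= 0.
Proof.
move=> a0 ab k'0 kk; have -> : (a - b) * k + (a + b) * k' =
   - ((b - a) * (k - k')) + 2 * (a * k') by ring.
rewrite -[leRHS]addr0 lerD ?oppr_le0 ?mulr_ge0 ?subr_ge0//.
by rewrite pmulr_rle0// mulr_le0_ge0.
Qed.

Lemma folded_kernel_le {R : realType} (a b k k' k0 : R) :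
  a <= 0 -> a <= b -> k' <= k -> k0 <= k' ->
  (a - b) * k + (a + b) * k' <= 2 * a * k0.
Proof.
move=> a0 ab kk k0k; have -> : (a - b) * k + (a + b) * k' =
   - ((b - a) * (k - k')) + 2 * (a * (k' - k0)) + 2 * a * k0 by ring.
rewrite gerDr -[leRHS]addr0 lerD ?oppr_le0 ?mulr_ge0 ?subr_ge0//.
by rewrite pmulr_rle0// mulr_le0_ge0// subr_ge0.
Qed.

Lemma sum_le_of_dist {R : realType} (a b e : R) :
  a <= 0 -> `|a - b| < e -> a + b <= e.
Proof. by move=> a0; rewrite ltr_norml => /andP[]; lra. Qed.

(** Folding counts the difference [a] of the truncated integrals twice, and the error is spread over
    a unit cube and its mirror image, of volume [b] each. *)
Lemma halve_le {R : realType} (a b c k eps eta : R) : eps * b = eta ->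
  a + a <= - c * k + eps * (b + b) -> a <= - (c * k / 2) + eta.
Proof. by move=> <-; rewrite mulrDr mulNr; lra. Qed.

Lemma le_of_eqs {R : realType} (a b a' b' : R) : a = a' -> b = b' -> a <= b -> a' <= b'.
Proof. by move=> -> ->. Qed.

(** * Comparing the half-Laplacian at mirror points *)

Section comparison.
Context {R : realType} {n : nat}.
Implicit Types (x y q : 'rV[R]_n).
Variables (x0 nu : 'rV[R]_n) (lam : R).
Hypothesis nu1 : dot nu nu = 1.
Local Notation h y := (dot (y - x0) nu).
Local Notation rf := (refl x0 nu lam).

Lemma sqr_enorm_refl x y :
  enorm (x - rf y) ^+ 2 = enorm (x - y) ^+ 2 + 4 * (lam - h x) * (lam - h y).
Proof.
rewrite !sqr_enorm /refl opprD addrA.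
set s := 2 * (lam - h y).
have -> : dot (x - y - s *: nu) (x - y - s *: nu) =
    dot (x - y) (x - y) - 2 * s * dot (x - y) nu + s ^+ 2.
  by rewrite !(dotBl (x - y) _ _, dotBr (x - y) _ _, dotBr _ (x - y), dotZl, dotZr) nu1 (dotC nu); ring.
have -> : dot (x - y) nu = h x - h y by rewrite -dotBl opprB addrA subrK.
by rewrite /s; ring.
Qed.

Lemma enorm_refl_ge x y : h x <= lam -> h y <= lam ->
  enorm (x - y) <= enorm (x - rf y).
Proof.
move=> hx hy; rewrite -(@ler_pXn2r _ 2) ?nnegrE ?enorm_ge0// (sqr_enorm_refl x y).
by rewrite lerDl !mulr_ge0// subr_ge0.
Qed.

Lemma abs_dot_le_enorm (z : 'rV[R]_n) : `|dot z nu| <= enorm z.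
Proof.
rewrite -(@ler_pXn2r _ 2)// ?nnegrE ?normr_ge0 ?enorm_ge0// real_normK ?num_real//.
rewrite sqr_enorm -subr_ge0.
have -> : dot z z - dot z nu ^+ 2 = dot (z - dot z nu *: nu) (z - dot z nu *: nu).
  rewrite !(dotBl, dotBr, dotZl, dotZr) nu1 (dotC nu); ring.
exact: dot_ge0.
Qed.

Lemma dot_refl_le y : lam <= h y -> h (rf y) <= lam.
Proof. by move=> hy; rewrite dot_refl//; lra. Qed.

(** The mirror image of y lies beyond the plane, at least as far from x as the plane itself; this
    bounds the reflected kernel when y is close to x. *)
Lemma dist_plane_le x y : h y <= lam -> lam - h x <= enorm (x - rf y).
Proof.
move=> hy; apply: le_trans (abs_dot_le_enorm _); rewrite ler_normr; apply/orP; right.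
have -> : dot (x - rf y) nu = h x - h (rf y) by rewrite -dotBl opprB addrA subrK.
by rewrite dot_refl//; lra.
Qed.

Lemma riesz_kernel_ge0 x y : 0 <= riesz_kernel x y.
Proof. by rewrite invr_ge0 powR_ge0. Qed.

Lemma riesz_kernel_le x y (a : R) : 0 < a -> a <= enorm (x - y) ->
  riesz_kernel x y <= (a `^ (n%:R + 2 * 2^-1))^-1.
Proof.
move=> a0 ale; rewrite /riesz_kernel lef_pV2 ?posrE ?powR_gt0//; last exact: lt_le_trans ale.
by apply: ge0_ler_powR; rewrite ?nnegrE ?enorm_ge0 ?addr_ge0 ?mulr_ge0// ltW.
Qed.

Lemma riesz_kernel_ge x y (a : R) : 0 < enorm (x - y) -> enorm (x - y) <= a ->
  (a `^ (n%:R + 2 * 2^-1))^-1 <= riesz_kernel x y.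
Proof.
move=> e0 ea; have a0 := lt_le_trans e0 ea.
rewrite /riesz_kernel lef_pV2 ?posrE ?powR_gt0//.
by apply: ge0_ler_powR; rewrite ?nnegrE ?enorm_ge0 ?addr_ge0 ?mulr_ge0// ltW.
Qed.

Lemma riesz_kernel_antimono x y y' : 0 < enorm (x - y) ->
  enorm (x - y) <= enorm (x - y') -> riesz_kernel x y' <= riesz_kernel x y.
Proof. by move=> e0 ele; exact: riesz_kernel_le. Qed.

Lemma truncated_refl (v : 'rV[R]_n -> R) x delta y :
  truncated v (rf x) delta (rf y) - truncated v x delta y =
  if delta <= enorm (x - y)
  then ((v (rf x) - v x) - (v (rf y) - v y)) * riesz_kernel x y else 0.
Proof.
rewrite /truncated /riesz_kernel (enorm_refl nu1).
by case: ifP => _; [ring|rewrite subrr].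
Qed.

Variables (v : 'rV[R]_n -> R) (x : 'rV[R]_n).
Hypotheses (cv : continuous v) (hx : h x < lam).
Local Notation w y := (v (rf y) - v y).

(* Folding the half space [h > lam] onto [h < lam], the difference of the two
   truncated integrals becomes the integral of the left-hand side of the
   hypothesis on [ball q r], which is nonpositive wherever both [y] and its
   reflection survive the truncation. *)
Lemma frac_laplacian_refl_le q (r c rho : R) :
  0 < frac_laplacian 2^-1 v x -> 0 < frac_laplacian 2^-1 v (rf x) ->
  w x <= 0 -> (forall y, h y <= lam -> w x <= w y) ->
  0 < r -> 0 <= c -> 0 < rho ->
  (forall y, ball q r y -> [/\ h y < lam, rho <= enorm (x - y) &
    (w x - w y) * riesz_kernel x y + (w x + w y) * riesz_kernel x (rf y) <= - c]) ->
  frac_laplacian 2^-1 v (rf x) - frac_laplacian 2^-1 v x <=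
    - (@frac_const R n 2^-1 * (c * (2 * r) ^+ n / 2)).
Proof.
move=> P1 P2 wx0 wmin r0 c0 rho0 HQ.
(* Abstracting the reflection keeps conversion checks from unfolding it. *)
have [s sE] : exists s, s = rf by exists rf.
have sK : involutive s by rewrite sE; exact: reflK.
have sC : continuous s by rewrite sE; exact: continuous_refl.
have s_trunc delta y := truncated_refl v x delta y.
have s_ge y := @enorm_refl_ge x y (ltW hx).
have s_le := dot_refl_le.
have s_dist := dist_plane_le x.
have s_int g := @Rn_integral_refl R n nu nu1 x0 lam g.
rewrite -sE in P2 wx0 wmin HQ s_trunc s_ge s_le s_dist s_int *.
move: {sE} s sK sC s_trunc s_ge s_le s_dist s_int P2 wx0 wmin HQ => s sK sC.
move=> s_trunc s_ge s_le s_dist s_int P2.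
have [om omE] : exists om, om = (fun y => v (s y) - v y) by eexists.
have wEy y : v (s y) - v y = om y by rewrite omE.
rewrite wEy => wx0 wmin HQ.
have {}wmin y : h y <= lam -> om x <= om y by rewrite -(wEy y); exact: wmin.
have {}HQ y : ball q r y -> [/\ h y < lam, rho <= enorm (x - y) &
    (om x - om y) * riesz_kernel x y + (om x + om y) * riesz_kernel x (s y) <= - c].
  by rewrite -(wEy y); exact: HQ.
have {}s_trunc delta y : truncated v (s x) delta (s y) - truncated v x delta y =
    if delta <= enorm (x - y) then (om x - om y) * riesz_kernel x y else 0.
  by rewrite s_trunc !wEy.
have [_ [L2 cL2 [-> L20]]] := frac_laplacian_gt0 P1.
have [C0 [L1 cL1 [-> L10]]] := frac_laplacian_gt0 P2.
rewrite -mulrBr -mulrN ler_pM2l//.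
apply/ler_addgt0Pr => eta eta0.
have I0 (B : set 'rV[R]_n) y : 0 <= \1_B y :> R by rewrite indicE ler0n.
(* Error budget for the y removed by the truncation whose mirror images remain. There w x + w y <=
   eps' by continuity and w x <= 0, and the reflected kernel is at most d^-(n+1), so the integrand
   is at most eps on a cube of volume 2^n. *)
pose eps := eta / (2 * 1) ^+ n.
have eps0 : 0 < eps by rewrite divr_gt0// exprn_gt0.
pose d := lam - h x.
have d0 : 0 < d by rewrite subr_gt0.
pose eps' := eps * d `^ (n%:R + 2 * 2^-1).
have de0 : 0 < d `^ (n%:R + 2 * 2^-1) by rewrite powR_gt0.
have eps'0 : 0 < eps' by rewrite mulr_gt0.
have epsE : eps' * (d `^ (n%:R + 2 * 2^-1))^-1 = eps by rewrite mulfK ?gt_eqF.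
have cw : continuous om.
  rewrite omE.
  move=> y; apply: (@cvgB _ _ _ (nbhs y) _ (v \o s) v); last exact: cv.
  by apply: continuous_comp; [exact: sC|exact: cv].
have : \forall y \near x, `|om x - om y| < eps'.
  by move/cvgrPdist_lt : (cw x); apply.
move=> /nbhs_ballP[r1 /= r10 Hr1].
have ws y : om (s y) = - om y by rewrite -!wEy sK opprB.
have cL : (Rn_integral (truncated v (s x) delta) - Rn_integral (truncated v x delta))
    @[delta --> 0^'+] --> L1 - L2 by exact: cvgB.
apply: (@cvgr_to_le _ _ _ _ _ _ _ cL).
have ni1 := truncated_integrable cv L10 cL1.
have ni2 := truncated_integrable cv L20 cL2.
(* delta < rho keeps [ball q r] clear of the truncated ball, delta < r1 makes the continuity bound
   available on that ball, and delta < 1 puts it inside [ball x 1]. *)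
have nd : \forall delta \near (0 : R)^'+,
    [/\ 0 < delta, delta < rho, delta < r1 & delta < 1].
  near=> delta; split; near: delta.
  - exact: nbhs_right_gt.
  - exact: nbhs_right_lt.
  - exact: nbhs_right_lt.
  - exact: nbhs_right_lt.
apply: filterS3 ni1 ni2 nd => delta i1 i2 [dl0 dlrho dlr1 dl1].
(* Substituting y := s y in the integral centred at s x leaves a single kernel, centred at x. *)
pose F y := truncated v (s x) delta (s y) - truncated v x delta y.
have [i1' e1'] := s_int _ i1.
have [iF eF] : Rn_integrable F /\ Rn_integral F = _ - _ := Rn_integralB i1' i2.
have FE y : F y = if delta <= enorm (x - y) then (om x - om y) * riesz_kernel x y else 0.
  exact: s_trunc.
clearbody F.
have [iFr eFr] := s_int _ iF.
have [iG eG] := Rn_integralD iF iFr.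
have [iQ eQ] := Rn_indic_ball q r0.
have [iB eB] := Rn_indic_ball x (@ltr01 R).
have [iBr eBr] := s_int _ iB.
have [iBB eBB] := Rn_integralD iB iBr.
have [iBe eBe] := Rn_integralZ eps iBB.
have [iQc eQc] := Rn_integralZ (- c) iQ.
have [iR eR] := Rn_integralD iQc iBe.
have claim y : h y <= lam ->
    F y + F (s y) <= - c * \1_(ball q r) y + eps * \1_(ball x 1) y.
  move=> hy; rewrite !FE ws opprK.
  have [dle|dgt] := leP delta (enorm (x - y)).
    have le2 := s_ge y hy.
    rewrite (le_trans dle le2) indicE.
    have eps1 : 0 <= eps * \1_(ball x 1) y by exact: mulr_ge0 (ltW eps0) (I0 _ _).
    have [yQ|yQ] := boolP (y \in (ball q r : set 'rV[R]_n)).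
      rewrite mulr1; have [|_ _] := HQ y; first by rewrite -in_setE.
      by move=> /le_trans; apply; rewrite lerDl.
    rewrite mulr0 add0r; apply: (le_trans _ eps1).
    have kk := riesz_kernel_antimono (lt_le_trans dl0 dle) le2.
    have k'0 := riesz_kernel_ge0 x (s y).
    have wy := wmin y hy.
    exact: folded_kernel_le0 wx0 wy k'0 kk.
  have yB : y \in (ball x 1 : set 'rV[R]_n).
    rewrite in_setE -ball_normE /=; apply: le_lt_trans dl1.
    by apply: le_trans (norm_le_enorm _) _; exact: ltW.
  have yQ : y \in (ball q r : set 'rV[R]_n) = false.
    apply/negP => /set_mem /HQ[_ h2 _].
    by have := lt_trans dgt dlrho; rewrite ltNge h2.
  rewrite !indicE yB yQ mulr0 !add0r mulr1.
  case: ifP => _; last exact: ltW.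
  have dle : d <= enorm (x - s y) by exact: s_dist.
  have k'le := riesz_kernel_le d0 dle.
  have k'0 := riesz_kernel_ge0 x (s y).
  have wy : om x + om y <= eps'.
    apply: (sum_le_of_dist wx0); apply: Hr1; rewrite -ball_normE /=.
    by apply: le_lt_trans (norm_le_enorm _) _; exact: lt_trans dlr1.
  apply: le_trans (ler_wpM2r k'0 wy) _.
  apply: le_trans (ler_wpM2l (ltW eps'0) k'le) _.
  by rewrite epsE lexx.
(* The left side is symmetric in y and s y, so above the plane [claim] is applied to s y; [ball q r]
   lies below the plane. *)
have GR y : F y + F (s y) <=
    - c * \1_(ball q r) y + eps * (\1_(ball x 1) y + \1_(ball x 1) (s y)).
  have [hy|hy] := leP (h y) lam.
    apply: le_trans (claim y hy) _.
    by rewrite mulrDr addrA lerDl; exact: mulr_ge0 (ltW eps0) (I0 _ _).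
  have hry : h (s y) <= lam by exact: s_le _ (ltW hy).
  have := claim (s y) hry; rewrite (sK y) (addrC (F (s y))).
  move=> /le_trans; apply.
  have yQ : y \in (ball q r : set 'rV[R]_n) = false.
    by apply/negP => /set_mem /HQ[h2 _ _]; move: (lt_trans h2 hy); rewrite ltxx.
  rewrite [\1_(ball q r) y]indicE yQ mulr0 add0r mulrDr lerD2r.
  apply: (@le_trans _ _ 0); last exact: mulr_ge0 (ltW eps0) (I0 _ _).
  by rewrite mulNr oppr_le0; exact: mulr_ge0 c0 (I0 _ _).
have eF' := etrans eF (congr1 (fun z => z - _) e1').
have EL := etrans eG (congr2 +%R eF' (etrans eFr eF')).
have ER := etrans eR (congr2 +%R (etrans eQc (congr1 ( *%R (- c)) eQ))
  (etrans eBe (congr1 ( *%R eps) (etrans eBB (congr2 +%R eB (etrans eBr eB)))))).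
have H := le_of_eqs EL ER (le_Rn_integral iG iR GR).
have epsK : eps * (2 * 1) ^+ n = eta by rewrite divfK// gt_eqF// exprn_gt0.
exact: halve_le epsK H.
Unshelve. all: by end_near.
Qed.

End comparison.

(** * Reflected caps of a strictly convex domain *)

Section geometry.
Context {R : realType} {n : nat}.
Implicit Types (x y z v nu : 'rV[R]_n) (Omega U : set 'rV[R]_n).

Lemma closure_near Omega y (P : set 'rV[R]_n) : closure Omega y ->
  (\forall z \near y, P z) -> exists2 z, Omega z & P z.
Proof. by move=> cy nP; have [z [Oz Pz]] := cy _ nP; exists z. Qed.

Lemma cvg_dot (f : 'rV[R]_n -> 'rV[R]_n) x v :
  (forall i, {for x, continuous (fun y => f y 0 i)}) ->
  dot (f y) v @[y --> nbhs x] --> dot (f x) v.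
Proof.
move=> cf; apply: (@cvg_sum _ (nbhs x) _ R R^o _ _ _ (fun i y => f y 0 i * v 0 i)) => i _.
by apply: cvgM; [exact: cf|exact: cvg_cst].
Qed.

Lemma compact_closure Omega : bounded_set Omega -> compact (closure Omega).
Proof.
move=> [M [Mr bM]]; apply: bounded_closed_compact; last exact: closed_closure.
exists (M + 1); split; first by rewrite realD.
move=> a Ma y cy; have [z Oz yz] : exists2 z, Omega z & `|y - z| < a - (M + 1).
  apply: closure_near cy _; apply/nbhs_ballP; exists (a - (M + 1)); first by rewrite /= subr_gt0.
  by move=> z; rewrite -ball_normE.
have zM : `|z| <= M + 1 by apply: bM => //; rewrite ltrDl.
rewrite /= -[y](subrK z); apply: le_trans (ler_normD _ _) _.
by move: yz zM; lra.
Qed.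

Section boundary_point.
Variables (Omega U : set 'rV[R]_n) (x0 : 'rV[R]_n) (rho : 'rV[R]_n -> R).
Hypotheses (oO : open Omega) (bO : bounded_set Omega)
  (scO : strictly_convex Omega) (bx0 : boundary Omega x0)
  (ldf : local_defining_function Omega x0 U rho).

Let oU : open U. Proof. by case: ldf. Qed.
Let Ux0 : U x0. Proof. by case: ldf. Qed.

Let cx0 : closure Omega x0. Proof. by case: bx0. Qed.
Let nOx0 : ~ Omega x0.
Proof. by case: bx0 => _; move/interior_id : oO => ->. Qed.

Let rho_derive y v : U y -> is_derive y v rho (dot (grad rho y) v).
Proof.
move=> Uy; have [_ _ sm _ _] := ldf.
rewrite dotC (_ : dot _ _ = \sum_(i < n) v 0 i * partial i rho y); last first.
  by apply: eq_bigr => i _; rewrite mxE.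
apply: (is_derive_dir v oU Uy) => [i z Uz|i].
  by have [d _] := sm 1%N; exact: (d [::]).
by have [_ c] := sm 1%N; exact: (c [:: i]).
Qed.

Let rho_continuous y : U y -> rho z @[z --> nbhs y] --> rho y.
Proof. by move=> Uy; have [_ _ sm _ _] := ldf; have [_ c] := sm 0%N; exact: (c [::]). Qed.

Let rho_ge0 y : closure Omega y -> U y -> 0 <= rho y.
Proof.
move=> cy Uy; rewrite leNgt; apply/negP => r0.
have n1 : \forall z \near y, rho z < 0 by exact: (cvgr_lt _ (rho_continuous Uy)).
have n2 : \forall z \near y, U z by exact: open_nbhs_nbhs.
have [z Oz [rz Uz]] : exists2 z, Omega z & rho z < 0 /\ U z.
  by apply: closure_near cy _; near=> z; split; near: z.
have [_ _ _ _ /(_ z Uz)[/(_ Oz)]] := ldf.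
by move=> /lt_trans /(_ rz); rewrite ltxx.
Unshelve. all: by end_near.
Qed.

Let g0 : 0 < enorm (grad rho x0).
Proof. by rewrite enorm_gt0; case: ldf => _ _ _ /(_ x0 Ux0). Qed.

Definition normal : 'rV[R]_n := (enorm (grad rho x0))^-1 *: grad rho x0.
Local Notation nu := normal.

Lemma normal_unit : dot nu nu = 1.
Proof.
by rewrite /normal dotZl dotZr -sqr_enorm expr2 mulKf ?mulVf// gt_eqF.
Qed.

Let grad_normal v : dot (grad rho x0) v = enorm (grad rho x0) * dot v nu.
Proof. by rewrite /normal dotZr mulVKf ?gt_eqF// dotC. Qed.

(** By strict convexity the open segment from x0 to z lies in Omega, where rho > 0; but rho x0 <= 0,
    and rho would decrease at x0 in the direction z - x0. *)
Let supporting_strict z : Omega z -> dot (z - x0) nu < 0 -> False.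
Proof.
move=> Oz hz.
have zx0 : z != x0 by apply/eqP => zx; apply: nOx0; rewrite -zx.
have D : is_derive (x0 + 0 *: (z - x0)) (z - x0) rho (dot (grad rho x0) (z - x0)).
  by rewrite scale0r addr0; exact: rho_derive.
have /is_deriveP := is_derive_line D; rewrite grad_normal => cD.
have neg : enorm (grad rho x0) * dot (z - x0) nu < 0 by rewrite pmulr_rlt0.
have n1 := cvgr_lt _ cD _ neg.
have n2 : \forall t \near (0 : R), U (x0 + t *: (z - x0)).
  by apply: near_line; exact: open_nbhs_nbhs.
have [e1 /= e10 H1] := n1; have [e2 /= e20 H2] := n2.
pose m := Num.min 1 (Num.min e1 e2).
have m0 : 0 < m by rewrite !lt_min ltr01 e10.
pose t := m / 2.
have t0 : 0 < t by rewrite divr_gt0.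
have : t < m by rewrite ltr_pdivrMr// ltr_pMr// ltr1n.
rewrite !lt_min => /and3P[t1 te1 te2].
have Ut : U (x0 + t *: (z - x0)) by apply: H2; rewrite /= sub0r normrN gtr0_norm.
have Ot : Omega (x0 + t *: (z - x0)).
  move/interior_id : oO => <-.
  have -> : x0 + t *: (z - x0) = t *: z + (1 - t) *: x0.
    by rewrite scalerBr scalerBl scale1r addrCA addrA addrAC.
  apply: scO => //; first exact: subset_closure.
  by rewrite t0.
have := H1 t; rewrite /= sub0r normrN gtr0_norm// => /(_ te1 (lt0r_neq0 t0)).
have [_ _ _ _ rhoP] := ldf.
have rt : 0 < rho (x0 + t *: (z - x0)) by apply/rhoP.
have r0 : rho x0 <= 0 by rewrite leNgt; apply/negP => /(rhoP _ Ux0).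
rewrite addr0 scale0r addr0 pmulr_rlt0 ?invr_gt0// subr_lt0 => /(lt_trans rt).
by rewrite ltNge r0.
Qed.

(** Otherwise the midpoint of y and x0, which is in the open set Omega, could be pushed along - nu
    to a point of Omega of negative height. *)
Lemma height_gt0 y : closure Omega y -> y != x0 -> 0 < dot (y - x0) nu.
Proof.
move=> cy yx0; rewrite ltNge; apply/negP => hy.
pose z := 2^-1 *: y + (1 - 2^-1) *: x0.
have Oz : Omega z.
  move/interior_id : oO => <-; apply: scO => //.
  by rewrite invr_gt0 ltr0n invf_lt1// ltr1n.
have hz : dot (z - x0) nu <= 0.
  have -> : z - x0 = 2^-1 *: (y - x0).
    by rewrite /z scalerBl scale1r scalerBr addrCA addrAC subrr add0r.
  by rewrite dotZl pmulr_rle0// invr_gt0.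
have n1 : \forall t \near (0 : R), Omega (z + t *: (- nu)).
  by apply: near_line; exact: open_nbhs_nbhs.
have [e /= e0 He] := n1.
apply: (@supporting_strict (z + (e / 2) *: (- nu))).
  apply: He; rewrite /= sub0r normrN gtr0_norm ?divr_gt0//.
  by rewrite ltr_pdivrMr// ltr_pMr// ltr1n.
rewrite addrAC dotDl dotZl dotNl normal_unit.
have : 0 < e / 2 by rewrite divr_gt0.
by move: hz; lra.
Qed.

Lemma height_ge0 y : closure Omega y -> 0 <= dot (y - x0) nu.
Proof.
move=> cy; have [->|/(height_gt0 cy)/ltW//] := eqVneq y x0.
by rewrite subrr /dot big1// => i _; rewrite mxE mul0r.
Qed.

(** Near x0 the function rho increases along nu. A low cap is contained in a small neighbourhood of
    x0, and the reflection moves its points a short way along nu, from rho >= 0 to rho > 0. *)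
Lemma reflected_cap_sub : exists2 lam0 : R, 0 < lam0 &
  forall lam y, closure Omega y -> lam <= lam0 -> dot (y - x0) nu < lam ->
    Omega (refl x0 nu lam y).
Proof.
have [_ _ sm _ rhoP] := ldf.
have n1 : \forall y \near x0, 0 < dot (grad rho y) nu.
  have c : dot (grad rho y) nu @[y --> nbhs x0] --> dot (grad rho x0) nu.
    apply: cvg_dot => i.
    rewrite (_ : (fun y => _) = partial i rho); last by apply/funext => y; rewrite mxE.
    by have [_ c] := sm 1%N; exact: (c [:: i]).
  by apply: (cvgr_gt _ c); rewrite grad_normal normal_unit mulr1.
have n2 : \forall y \near x0, U y by exact: open_nbhs_nbhs.
have [r /= r0 Hr] : exists2 r : R, 0 < r &
    forall y, `|x0 - y| < r -> 0 < dot (grad rho y) nu /\ U y.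
  have : \forall y \near x0, 0 < dot (grad rho y) nu /\ U y by near=> y; split; near: y.
  move=> /nbhs_ballP[r r0 Hr]; exists r => // y yr; apply: Hr.
  by rewrite -ball_normE.
have [c c0 Hc] : exists2 c : R, 0 < c &
    forall y, closure Omega y -> dot (y - x0) nu < c -> `|x0 - y| < r / 2.
  (* On the compact remainder the height is positive, hence bounded below by some c > 0; points of
     lower height are close to x0. *)
  pose K := closure Omega `\` ball x0 (r / 2).
  have cK : compact K.
    apply: (subclosed_compact _ (compact_closure bO)); last by move=> y [].
    rewrite /K setDE; apply: closedI; first exact: closed_closure.
    by apply: open_closedC; exact: ball_open.
  have [K0|/set0P/negP/negPn/eqP K0] := pselect (K !=set0); last first.
    exists 1 => // y cy _; apply/negPn/negP => yr.
    suff : K y by rewrite K0.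
    by split => //; rewrite -ball_normE; exact/negP.
  have ch : {within K, continuous (fun y => dot (y - x0) nu)}.
    apply: continuous_subspaceT => y.
    rewrite (_ : (fun y => _) = fun y => dot y nu - dot x0 nu); last first.
      by apply/funext => z; rewrite dotBl.
    apply: (@cvgB _ _ _ (nbhs y) _ (fun y => dot y nu) (fun=> dot x0 nu)).
      exact: continuous_dotr.
    exact: cvg_cst.
  have [k Kk kmin] := EVT_min_rV K0 cK ch.
  move: Kk; rewrite inE => -[ck kr].
  exists (dot (k - x0) nu).
    apply: height_gt0 => //; apply/eqP => kx0; apply: kr; rewrite kx0; apply: ballxx.
    by rewrite divr_gt0.
  move=> y cy hy; apply/negPn/negP => yr.
  have Ky : y \in K by rewrite inE; split => //; rewrite -ball_normE; exact/negP.
  by have := kmin y Ky; rewrite leNgt hy.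
(* With lam <= r / 4 and nonnegative heights, the displacement 2 (lam - h y) is at most r / 2, so
   the whole segment stays within r of x0. *)
exists (Num.min c (r / 4)); first by rewrite lt_min c0 divr_gt0.
move=> lam y cy; rewrite le_min => /andP[lc lr] hy.
have hy0 := height_ge0 cy.
have yr := Hc y cy (lt_le_trans hy lc).
pose d := 2 * (lam - dot (y - x0) nu).
have d0 : 0 < d by rewrite mulr_gt0// subr_gt0.
have dr : d <= r / 2 by rewrite /d; move: hy0 lr; lra.
have nu_le : `|nu| <= 1.
  by apply: le_trans (norm_le_enorm _) _; rewrite /enorm normal_unit sqrtr1.
have inr s : `|s| <= `|d| -> `|x0 - (y + s *: nu)| < r.
  rewrite (gtr0_norm d0) => sd; rewrite opprD addrA.
  apply: le_lt_trans (ler_normB _ _) _; rewrite normrZ.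
  have : `|s| * `|nu| <= r / 2.
    by rewrite (le_trans _ (le_trans sd dr))// ler_piMr.
  by move: yr; lra.
have [s sd E] : exists2 s, `|s| <= `|d| &
    rho (y + d *: nu) - rho y = d * 'D_nu rho (y + s *: nu).
  apply: MVT_line => s /inr /Hr[_ Us].
  by have [] := rho_derive nu Us.
have [gs Us] := Hr _ (inr s sd).
have [_ dE] := rho_derive nu Us.
have [_ Ud] := Hr _ (inr d (lexx _)).
apply/(rhoP _ Ud).
have ry : 0 <= rho y.
  apply: rho_ge0 => //; apply: (Hr _ _).2; apply: lt_trans yr _.
  by rewrite ltr_pdivrMr// ltr_pMr// ltr1n.
by rewrite (le_lt_trans ry)// -subr_gt0 E dE mulr_gt0.
Unshelve. all: by end_near.
Qed.

End boundary_point.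

End geometry.

(** * Chains of Navier problems and narrow strips *)

(** Convexity on the chord from b to M + 1: for b < a the point a divides it in a ratio t <= a - b,
    as the chord is at least 1 long, so a^p - b^p <= t (M + 1)^p. One-sided, because b need not be
    bounded by M. *)
Lemma powR_lipschitz {R : realType} (p M : R) : 1 <= p -> 0 <= M ->
  exists2 C : R, 0 <= C & forall a b e : R, 0 <= a <= M -> 0 <= b -> 0 <= e ->
    a - e <= b -> - (C * e) <= b `^ p - a `^ p.
Proof.
move=> p1 M0; exists ((M + 1) `^ p); first exact: powR_ge0.
move=> a b e /andP[a0 aM] b0 e0 ab.
have p0 : 0 <= p by apply: le_trans p1.
have [ab'|ba] := leP a b.
  apply: (@le_trans _ _ 0); first by rewrite oppr_le0 mulr_ge0// powR_ge0.
  by rewrite subr_ge0 ge0_ler_powR// nnegrE.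
pose t := (a - b) / (M + 1 - b).
have Mb : 0 < M + 1 - b by lra.
have t01 : 0 <= t <= 1.
  apply/andP; split; first by apply: divr_ge0; lra.
  by rewrite /t ler_pdivrMr// mul1r; lra.
have /andP[t01l t01r] := t01.
pose ti : {i01 R} := Itv01 t01l t01r.
have := @convex_powR R p p1 ti (M + 1) b.
rewrite !inE/= !in_itv/= !andbT => /(_ ltac:(lra) b0).
rewrite convRE [X in X `^ _ <= _]convRE /= /unstable.onem.
have -> : t * (M + 1) + (1 - t) * b = a by rewrite /t; field; lra.
move=> H.
have tab : t <= a - b.
  by rewrite /t ler_pdivrMr// ler_peMr ?subr_ge0 ?ltW//; lra.
have P0 : 0 <= b `^ p by exact: powR_ge0.
have Q0 : 0 <= (M + 1) `^ p by exact: powR_ge0.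
by move: H; nra.
Qed.

Section chains.
Context {R : realType} {n : nat}.
Variables (Omega : set 'rV[R]_n) (m : nat).
Implicit Types (x y z : 'rV[R]_n) (U V : nat -> 'rV[R]_n -> R).

(** What is kept of the family (-Delta)^i u. The equation at the top level stays outside, since it
    couples two chains. *)
Definition navier_chain U : Prop :=
  [/\ forall i, (i <= m)%N -> continuous (U i),
      forall i x, (i <= m)%N -> ~ Omega x -> U i x = 0,
      forall i, (i < m)%N -> C_open 2 Omega (U i) &
      forall i x, (i < m)%N -> Omega x -> neg_laplacian (U i) x = U i.+1 x].

Hypotheses (oO : open Omega) (cO : compact (closure Omega)).

(** If W x <= 0 and the minimum sits off Omega, where W is 0, then x attains it too. *)
Lemma gt0_of_no_interior_min (W : 'rV[R]_n -> R) :
  continuous W -> (forall x, ~ Omega x -> W x = 0) ->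
  (forall x, Omega x -> ~ (forall y, W x <= W y)) ->
  forall x, Omega x -> 0 < W x.
Proof.
move=> cW W0 nomin x Ox; rewrite ltNge; apply/negP => Wx.
have cx : closure Omega x by exact: subset_closure.
have [k _ kmin] := EVT_min_rV (ex_intro _ x cx) cO (continuous_subspaceT cW).
have kx : W k <= W x by apply: kmin; rewrite inE.
have gmin y : W k <= W y.
  have [Oy|Oy] := pselect (Omega y); last by rewrite [leRHS]W0// (le_trans kx).
  by apply: kmin; rewrite inE; exact: subset_closure.
have [Ok|Ok] := pselect (Omega k); first exact: (nomin k Ok).
apply: (nomin x Ox) => y; apply: le_trans (gmin y).
by rewrite (W0 k).
Qed.

Lemma frac_laplacian_at_min (W : 'rV[R]_n -> R) x : continuous W ->
  (forall y, W x <= W y) -> frac_laplacian 2^-1 W x <= 0.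
Proof.
move=> cW Wmin; rewrite leNgt; apply/negP => /frac_laplacian_gt0[_ [L cL [_ L0]]].
have iL := truncated_integrable cW L0 cL.
suff : L <= 0 by rewrite leNgt L0.
apply: (cvgr_to_le cL); apply: filterS iL => delta iT.
(* The zero function as a multiple of the integrand: integrable, with integral 0. *)
have [iZ EZ] := Rn_integralZ 0 iT; rewrite mul0r in EZ.
rewrite -[leRHS]EZ; apply: le_Rn_integral => // y; rewrite mul0r /truncated.
by case: ifP => // _; rewrite mulr_le0_ge0 ?subr_le0// riesz_kernel_ge0.
Qed.

(** Downward induction from m: once U_{i+1} > 0, the function U_i has no interior minimum. *)
Lemma navier_chain_gt0 U : navier_chain U ->
  (forall x, Omega x -> 0 < frac_laplacian 2^-1 (U m) x) ->
  forall i x, (i <= m)%N -> Omega x -> 0 < U i x.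
Proof.
move=> [cU U0 CU NU] fU.
suff H j : (j <= m)%N -> forall x, Omega x -> 0 < U (m - j)%N x.
  by move=> i x im; rewrite -(subKn im); apply: H; exact: leq_subr.
elim: j => [_|j IH jm]; apply: gt0_of_no_interior_min.
- by rewrite subn0; exact: cU.
- by move=> x; rewrite subn0; exact: U0.
- by rewrite subn0 => x Ox /(frac_laplacian_at_min (cU m (leqnn _))); rewrite leNgt fU.
- by apply: cU; exact: leq_subr.
- by move=> x; apply: U0; exact: leq_subr.
move=> x Ox xmin.
have mj : (m - j.+1 < m)%N by rewrite ltn_subrL (leq_trans _ jm).
have := neg_laplacian_at_min oO (CU _ mj) Ox (filterE _ xmin).
rewrite (NU _ _ mj Ox) subnSK// => h0.
by have := IH (ltnW jm) x Ox; rewrite ltNge h0.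
Qed.

Variables (x0 nu : 'rV[R]_n) (lam : R).
Hypothesis nu1 : dot nu nu = 1.
Local Notation h y := (dot (y - x0) nu).
Local Notation rf := (refl x0 nu lam).
Hypothesis rfO : forall y, closure Omega y -> h y < lam -> Omega (rf y).

Lemma refl_plane y : h y = lam -> rf y = y.
Proof. by move=> hy; rewrite /refl hy subrr mulr0 scale0r addr0. Qed.

Lemma continuous_height : continuous (fun y => h y).
Proof.
rewrite (_ : (fun y => _) = fun y => dot y nu - dot x0 nu); last first.
  by apply/funext => z; rewrite dotBl.
move=> y; apply: (@cvgB _ _ _ (nbhs y) _ (fun y => dot y nu) (fun=> dot x0 nu)).
  exact: continuous_dotr.
exact: cvg_cst.
Qed.

(** A violation gives w_i minus the barrier a minimum k in the strip with value below - A l^2, hence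
    w_i k < 0. This excludes the plane, the lower edge and the boundary of Omega, so k is interior,
    and there w_{i+1} k <= - 2 A < - A. *)
Lemma narrow_strip U i (l A : R) : navier_chain U ->
  (forall j x, (j <= m)%N -> 0 <= U j x) -> (i < m)%N -> 0 < A -> 
  (forall y, closure Omega y -> h y <= lam -> - A <= U i.+1 (rf y) - U i.+1 y) ->
  (forall y, closure Omega y -> h y <= lam - l -> 0 <= U i (rf y) - U i y) ->
  forall y, closure Omega y -> h y <= lam -> - (A * l ^+ 2) <= U i (rf y) - U i y.
Proof.
move=> [cU U0 CU NU] Uge0 im A0 Hi1 Hl y cy hy.
have cUi := cU i (ltnW im).
rewrite leNgt; apply/negP => wy.
have Al0 : 0 <= A * l ^+ 2 := mulr_ge0 (ltW A0) (sqr_ge0 l).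
have hyl : lam - l < h y.
  rewrite ltNge; apply/negP => /(Hl _ cy) wy0.
  by move: wy; rewrite ltNge (le_trans _ wy0)// oppr_le0.
pose K := closure Omega `&` [set z | lam - l <= h z <= lam].
pose g z := U i (rf z) - U i z - A * (lam - h z) ^+ 2.
have cK : compact K.
  apply: (subclosed_compact _ cO); last by move=> z [].
  apply: closedI; first exact: closed_closure.
  rewrite (_ : [set z | _] = (fun z => h z) @^-1` `[lam - l, lam]%classic); last first.
    by apply/seteqP; split=> z /=; rewrite in_itv.
  by apply: closed_comp => [z _|]; [exact: continuous_height|exact: interval_closed].
have cg : continuous g.
  move=> z; apply: (@cvgB _ _ _ (nbhs z) _ (fun z => U i (rf z) - U i z)).
    apply: (@cvgB _ _ _ (nbhs z) _ (U i \o rf) (U i)); last exact: cUi.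
    by apply: continuous_comp; [exact: continuous_refl|exact: cUi].
  apply: cvgM; first exact: cvg_cst.
  have c1 : (lam - h z) @[z --> nbhs z] --> lam - h z.
    by apply: (@cvgB _ _ _ (nbhs z) _ (fun=> lam)); [exact: cvg_cst|exact: continuous_height].
  by under eq_fun do rewrite expr2; rewrite expr2; exact: cvgM.
have Ky : K y by split => //=; rewrite hy ltW.
have [k kK kmin] := EVT_min_rV (ex_intro _ y Ky) cK (continuous_subspaceT cg).
move: kK; rewrite inE => -[ck /= /andP[lk kl]].
have gk : g k < - (A * l ^+ 2).
  apply: le_lt_trans (kmin y _) _; first by rewrite inE.
  apply: le_lt_trans wy; rewrite /g gerBl.
  by rewrite mulr_ge0 ?sqr_ge0// ltW.
have bk : - (A * l ^+ 2) <= - (A * (lam - h k) ^+ 2).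
  have l0 : 0 <= l by have := le_trans lk kl; rewrite gerBl.
  rewrite lerN2; apply: ler_wpM2l; first exact: ltW.
  by rewrite ler_pXn2r ?nnegrE ?subr_ge0// lerBlDl -lerBlDr.
have wk : U i (rf k) - U i k < 0.
  by move: gk bk; rewrite /g; move: (U i (rf k)) (U i k) => a b; lra.
have kl' : h k < lam.
  by rewrite lt_neqAle kl andbT; apply/eqP => /refl_plane E; move: wk; rewrite E subrr ltxx.
have lk' : lam - l < h k.
  by rewrite ltNge; apply/negP => /(Hl _ ck); rewrite leNgt wk.
have Ok : Omega k.
  apply: contrapT => Ok; move: wk; rewrite (U0 i k)// ?(ltnW im)// subr0.
  by rewrite ltNge Uge0// ltnW.
have Ork : Omega (rf k) by exact: rfO.
have gloc : \forall z \near k, g k <= g z.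
  have n1 : \forall z \near k, Omega z by exact: open_nbhs_nbhs.
  have n2 : \forall z \near k, lam - l < h z.
    by apply: (cvgr_gt _ (@continuous_height k)).
  have n3 : \forall z \near k, h z < lam.
    by apply: (cvgr_lt _ (@continuous_height k)).
  near=> z; apply: kmin; rewrite inE; split.
    by apply: subset_closure; near: z; exact: n1.
  by apply/andP; split; apply: ltW; near: z; [exact: n2|exact: n3].
have := neg_laplacian_refl_at_min nu1 oO (CU i im) Ok Ork gloc.
rewrite NU// NU// => H.
have := Hi1 k ck kl; rewrite leNgt => /negP; apply.
apply: le_lt_trans H _; rewrite ltrN2.
by rewrite ltr_pMl// ltr1n.
Unshelve. all: by end_near.
Qed.

(** As l <= 1, the gain - A l^2 can be weakened to - A, the input of the next level down. The factor
    l^2 of the last level is all that is kept. *)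
Lemma narrow_strip_iter U (l A : R) : navier_chain U ->
  (forall j x, (j <= m)%N -> 0 <= U j x) -> 0 < A -> 0 < l <= 1 ->
  (forall y, closure Omega y -> h y <= lam -> - A <= U m (rf y) - U m y) ->
  (forall i y, (i <= m)%N -> closure Omega y -> h y <= lam - l ->
     0 <= U i (rf y) - U i y) ->
  forall i y, (i < m)%N -> closure Omega y -> h y <= lam ->
    - (A * l ^+ 2) <= U i (rf y) - U i y.
Proof.
move=> nU Uge0 A0 /andP[l0 l1] Hm Hl.
have step i : (i < m)%N ->
  (forall y, closure Omega y -> h y <= lam -> - A <= U i.+1 (rf y) - U i.+1 y) ->
  forall y, closure Omega y -> h y <= lam -> - (A * l ^+ 2) <= U i (rf y) - U i y.
  by move=> im H; apply: (narrow_strip nU Uge0 im A0 H) => y; apply: Hl; exact: ltnW.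
have weak (a : R) : - (A * l ^+ 2) <= a -> - A <= a.
  by apply: le_trans; rewrite lerN2 ler_piMr ?(ltW A0)// expr_le1// ltW.
have all j : (j <= m)%N ->
    forall y, closure Omega y -> h y <= lam -> - A <= U (m - j)%N (rf y) - U (m - j)%N y.
  elim: j => [_|j IH jm y cy hy]; first by rewrite subn0.
  apply: weak; apply: step => //; first by rewrite ltn_subrL (leq_trans _ jm).
  by rewrite subnSK//; apply: IH; exact: ltnW.
move=> i y im; apply: step => // {}y; rewrite -(subKn im).
by apply: all; exact: leq_subr.
Qed.

End chains.

(** * Moving planes *)

Section reflected_minimum.
Context {R : realType} {n : nat}.
Variables (Omega : set 'rV[R]_n) (m : nat) (x0 nu : 'rV[R]_n) (lam0 : R).
Implicit Types (x y z : 'rV[R]_n) (U V : nat -> 'rV[R]_n -> R) (lam : R).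
Hypotheses (m0 : (0 < m)%N) (oO : open Omega) (cO : compact (closure Omega)).
Hypotheses (cx0 : closure Omega x0) (nOx0 : ~ Omega x0) (nu1 : dot nu nu = 1).
Local Notation h y := (dot (y - x0) nu).
Local Notation rf := (refl x0 nu).
Hypothesis h_ge0 : forall y, closure Omega y -> 0 <= h y.
Hypothesis rfO : forall lam y, closure Omega y -> lam <= lam0 -> h y < lam ->
  Omega (rf lam y).

Lemma height_x0 : h x0 = 0.
Proof. by rewrite subrr /dot big1// => i _; rewrite mxE mul0r. Qed.

Lemma closure_bounded : exists B : R, forall x, closure Omega x -> `|x| <= B.
Proof.
have [M [Mr HM]] := compact_bounded cO.
by exists (M + 1) => x cx; apply: (HM (M + 1)) => //; rewrite ltrDl.
Qed.

(** The cube [ball q r] has heights between -3 and -1: it is outside Omega, at distance at least 1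
    from its closure, and below every plane considered. Its fixed volume makes the constant of the
    nonlocal estimate independent of l and lam. *)
Let q := x0 - 2 *: nu.
Let r : R := (n.+1%:R)^-1.

Let r_gt0 : 0 < r. Proof. by rewrite invr_gt0. Qed.

Let norm_nu : `|nu| <= 1.
Proof. by apply: le_trans (norm_le_enorm _) _; rewrite /enorm nu1 sqrtr1. Qed.

Let ball_height y : ball q r y -> -3 <= h y <= -1.
Proof.
rewrite -ball_normE /= => yr.
have : `|h y + 2| <= 1.
  have -> : h y + 2 = dot (y - q) nu.
    have -> : y - q = (y - x0) + 2 *: nu by rewrite /q opprB addrCA addrC.
    by rewrite [RHS]dotDl dotZl nu1 mulr1.
  apply: le_trans (dot_le_norm _ _) _.
  apply: (@le_trans _ _ (n%:R * `|y - q|)); first by rewrite ler_piMr// mulr_ge0.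
  rewrite distrC; apply: (@le_trans _ _ (n%:R * r)); first by rewrite ler_wpM2l// ltW.
  by rewrite /r ler_pdivrMr// mul1r ler_nat.
by rewrite ler_norml; lra.
Qed.

Let ball_far x y : closure Omega x -> ball q r y -> 1 <= enorm (x - y).
Proof.
move=> cx /ball_height hy; apply: le_trans (abs_dot_le_enorm nu1 _).
have -> : dot (x - y) nu = h x - h y by rewrite -dotBl opprB addrA subrK.
by apply: le_trans (ler_norm _); have := h_ge0 cx; lra.
Qed.

Let ball_near : exists2 D : R, 0 < D & forall lam x y, 0 < lam -> lam <= lam0 ->
  closure Omega x -> ball q r y -> enorm (x - rf lam y) <= D.
Proof.
have [B HB] := closure_bounded.
have B0 : 0 <= B := le_trans (normr_ge0 _) (HB x0 cx0).
(* The terms bound x, y and the displacement 2 (lam - h y); the final 1 ensures D > 0. *)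
exists (n%:R * (B + (`|q| + 1) + 2 * (`|lam0| + 3)) + 1).
  by apply: ltr_wpDl => //; rewrite mulr_ge0// !addr_ge0// mulr_ge0// addr_ge0.
move=> lam x y l0 ll cx yr; have /andP[h3 h1] := ball_height yr.
apply: le_trans (enorm_le_norm _) _.
rewrite -[leLHS]addr0 lerD// ler_wpM2l// /refl opprD addrA.
apply: le_trans (ler_normB _ _) _; apply: lerD.
  apply: le_trans (ler_normB _ _) _; apply: lerD; first exact: HB.
  rewrite -[y](subrK q) addrC; apply: le_trans (ler_normD _ _) _; rewrite lerD2l.
  move: yr; rewrite -ball_normE /= distrC => /ltW /le_trans; apply.
  by rewrite invf_le1// ler1n.
rewrite normrZ; apply: (@le_trans _ _ `|2 * (lam - h y)|); first by rewrite ler_piMr.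
rewrite normrM ger0_norm// ler_wpM2l// ger0_norm; last by lra.
apply: lerD; last by lra.
exact: le_trans ll (ler_norm _).
Qed.

(** On [ball q r] the reflected kernel is at least D^-(n+1), so [folded_kernel_le] bounds the folded
    integrand there by a fixed multiple of w x. *)
Lemma frac_laplacian_refl_min : exists2 K : R, 0 < K &
  forall (W : 'rV[R]_n -> R) lam x, 0 < lam -> lam <= lam0 -> continuous W ->
  Omega x -> h x < lam ->
  0 < frac_laplacian 2^-1 W x -> 0 < frac_laplacian 2^-1 W (rf lam x) ->
  W (rf lam x) - W x <= 0 ->
  (forall y, h y <= lam -> W (rf lam x) - W x <= W (rf lam y) - W y) ->
  frac_laplacian 2^-1 W (rf lam x) - frac_laplacian 2^-1 W x <=
    K * (W (rf lam x) - W x).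
Proof.
have [D D0 HD] := ball_near.
pose C := @frac_const R n 2^-1.
pose kap := (D `^ (n%:R + 2 * 2^-1))^-1.
have kap0 : 0 < kap by rewrite invr_gt0 powR_gt0.
(* If the constant were not positive, no W would satisfy the hypotheses, and any K serves. *)
have [C0|C0] := ltP 0 C; last first.
  exists 1 => // W lam x _ _ _ _ _ /frac_laplacian_gt0[C0' _].
  by move: C0; rewrite leNgt C0'.
exists (C * (kap * (2 * r) ^+ n)).
  apply: mulr_gt0 => //; apply: mulr_gt0 => //; apply: exprn_gt0; exact: mulr_gt0.
move=> W lam x l0 ll cW Ox hx P1 P2 w0 wmin.
have cx : closure Omega x by exact: subset_closure.
have := @frac_laplacian_refl_le R n x0 nu lam nu1 W x cW hx q r
  (- (2 * (W (rf lam x) - W x) * kap)) 1 P1 P2 w0 wmin r_gt0 _ ltr01.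
set w := W (rf lam x) - W x in w0 wmin *.
have -> : - (@frac_const R n 2^-1 * (- (2 * w * kap) * (2 * r) ^+ n / 2)) =
  C * (kap * (2 * r) ^+ n) * w by rewrite /C; field.
apply; first by rewrite oppr_ge0 pmulr_lle0// pmulr_rle0.
move=> y yr; have /andP[h3 h1] := ball_height yr.
have hy : h y < lam by apply: le_lt_trans h1 _; apply: lt_trans l0; rewrite oppr_lt0.
have f1 := ball_far cx yr.
split => //; rewrite opprK.
have e1 := lt_le_trans ltr01 f1.
have e2 := enorm_refl_ge nu1 (ltW hx) (ltW hy).
have k1 := riesz_kernel_antimono e1 e2.
have k2 : kap <= riesz_kernel x (rf lam y).
  apply: riesz_kernel_ge; first exact: lt_le_trans e2.
  exact: HD.
exact: folded_kernel_le w0 (wmin y (ltW hy)) k1 k2.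
Qed.

End reflected_minimum.

Lemma weighted_gap_le {R : realType} (w0 w ka kb k k' : R) :
  0 <= w0 -> w0 / 2 <= w -> kb <= ka -> ka <= k -> k' <= kb ->
  - w * k + w * k' <= - (w0 / 2 * (ka - kb)).
Proof.
move=> w00 ww kk k1 k2.
have H1 : w0 / 2 * (ka - kb) <= w * (ka - kb) by rewrite ler_wpM2r// subr_ge0.
have w1 : 0 <= w by apply: le_trans ww; rewrite divr_ge0.
have H2 : w * (ka - kb) <= w * (k - k') by rewrite ler_wpM2l// lerB.
by rewrite lerNr; apply: le_trans (le_trans H1 H2) _; rewrite mulrBr mulNr opprD opprK.
Qed.

Lemma add_third_lt {R : realType} (a b : R) :
  a < b -> a + (b - a) / 3 < b - (b - a) / 3.
Proof. lra. Qed.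

Section moving_plane.
Context {R : realType} {n : nat}.
Variables (Omega : set 'rV[R]_n) (m : nat) (x0 nu : 'rV[R]_n) (lam0 : R).
Implicit Types (x y z : 'rV[R]_n) (U V : nat -> 'rV[R]_n -> R) (lam : R).
Hypotheses (m0 : (0 < m)%N) (oO : open Omega) (cO : compact (closure Omega)).
Hypotheses (cx0 : closure Omega x0) (nOx0 : ~ Omega x0) (nu1 : dot nu nu = 1).
Local Notation h y := (dot (y - x0) nu).
Local Notation rf := (refl x0 nu).
Hypothesis h_ge0 : forall y, closure Omega y -> 0 <= h y.
Hypothesis rfO : forall lam y, closure Omega y -> lam <= lam0 -> h y < lam ->
  Omega (rf lam y).
Local Notation chain := (navier_chain Omega m).

Definition positive_chain U : Prop :=
  chain U /\ forall i x, (i <= m)%N -> Omega x -> 0 < U i x.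

Lemma positive_chain_ge0 U i x : positive_chain U -> (i <= m)%N -> 0 <= U i x.
Proof.
move=> [[_ U0 _ _] Up] im; have [Ox|Ox] := pselect (Omega x); first exact/ltW/Up.
by rewrite U0.
Qed.

Lemma positive_chain_out U i lam y : positive_chain U -> (i <= m)%N ->
  ~ Omega y -> 0 <= U i (rf lam y) - U i y.
Proof.
by move=> pU im Oy; have [[_ U0 _ _] _] := pU; rewrite (U0 i y)// subr0 positive_chain_ge0.
Qed.

Lemma chain_bounded V : chain V -> exists2 M : R, 0 <= M & forall x, Omega x -> V 0%N x <= M.
Proof.
move=> [cV _ _ _].
have [k _ kmax] := EVT_max_rV (ex_intro _ x0 cx0) cO (continuous_subspaceT (cV 0%N isT)).
exists `|V 0%N k| => // x Ox; apply: le_trans (ler_norm _).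
by apply: kmax; rewrite inE; exact: subset_closure.
Qed.

Definition refl_ge U lam (a : R) i : Prop :=
  forall y, closure Omega y -> h y <= lam -> a <= U i (rf lam y) - U i y.

(** The case where the smaller of the two minima belongs to U; exchanging U and V gives the other
    case. *)
Lemma narrow_region_half U V (p : R) : 1 <= p ->
  positive_chain U -> positive_chain V ->
  (forall x, Omega x -> frac_laplacian 2^-1 (U m) x = V 0%N x `^ p) ->
  exists2 l0 : R, 0 < l0 & forall l lam A x, 0 < l <= 1 -> l <= l0 ->
    0 < lam -> lam <= lam0 -> 0 < A ->
    closure Omega x -> h x <= lam -> U m (rf lam x) - U m x = - A ->
    refl_ge U lam (- A) m -> refl_ge V lam (- A) m ->
    (forall i y, (i <= m)%N -> closure Omega y -> h y <= lam - l ->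
      0 <= V i (rf lam y) - V i y) -> False.
Proof.
move=> p1 pU pV eqU.
have [cU Up] := pU; have [cV Vp] := pV.
have [M M0 VM] := chain_bounded cV.
have [C C0 HC] := powR_lipschitz p1 M0.
have [K K0 HK] := frac_laplacian_refl_min lam0 cO cx0 nu1 h_ge0.
have C10 : 0 < C + 1 by rewrite ltr_wpDl.
(* The estimates end in K A <= C A l^2, whereas C l^2 <= C l <= C K / (C + 1) < K. *)
exists (K / (C + 1)); first by rewrite divr_gt0.
move=> l lam A x l01 lK lam_gt lam_le A0 cx hx wx wU wV strip.
have /andP[l0 l1] := l01.
have wx0 : U m (rf lam x) - U m x < 0 by rewrite wx oppr_lt0.
have hxl : h x < lam.
  rewrite lt_neqAle hx andbT; apply/eqP => /refl_plane E.
  by move: wx0; rewrite E subrr ltxx.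
have Ox : Omega x.
  by apply: contrapT => /(positive_chain_out lam pU (leqnn m)); rewrite leNgt wx0.
have Orx : Omega (rf lam x) by exact: rfO.
have wmin y : h y <= lam -> U m (rf lam x) - U m x <= U m (rf lam y) - U m y.
  move=> hy; rewrite wx; have [cy|cy] := pselect (closure Omega y); first exact: wU.
  apply: (@le_trans _ _ 0); first by rewrite oppr_le0 ltW.
  by apply: positive_chain_out => // Oy; apply: cy; exact: subset_closure.
have V0x : - (A * l ^+ 2) <= V 0%N (rf lam x) - V 0%N x.
  have rfl y : closure Omega y -> h y < lam -> Omega (rf lam y) by move=> cy; exact: rfO.
  apply: (@narrow_strip_iter R n Omega m oO cO x0 nu lam nu1 rfl V l A cV _ A0 l01 wV strip) => //.
  by move=> j y jm; exact: positive_chain_ge0.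
have Pf y : Omega y -> 0 < frac_laplacian 2^-1 (U m) y.
  by move=> Oy; rewrite eqU// powR_gt0// Vp.
have [cUm _ _ _] := cU.
have := HK (U m) lam x lam_gt lam_le (cUm m (leqnn m)) Ox hxl (Pf x Ox) (Pf _ Orx) (ltW wx0) wmin.
rewrite wx !eqU//.
have A0l : 0 <= A * l ^+ 2 by rewrite mulr_ge0 ?sqr_ge0// ltW.
have := HC (V 0%N x) (V 0%N (rf lam x)) (A * l ^+ 2).
move: (Vp 0%N x isT Ox) (VM x Ox) (Vp 0%N _ isT Orx) V0x.
move: (V 0%N x) (V 0%N (rf lam x)) => a b a0 aM b0 ab.
have a0M : 0 <= a <= M by rewrite ltW.
have abl : a - A * l ^+ 2 <= b.
  by rewrite -subr_ge0 opprB addrA [b + _]addrC -addrA -[A * _]opprK addrC subr_ge0.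
move=> /(_ a0M (ltW b0) A0l abl) H1 /(le_trans H1).
rewrite mulrN lerN2 [K * A]mulrC [C * _]mulrCA (ler_pM2l A0) leNgt => /negP; apply.
apply: (@le_lt_trans _ _ (C * l)).
  by rewrite ler_wpM2l// expr2 ler_piMr// ltW.
apply: (@le_lt_trans _ _ (C * (K / (C + 1)))); first by rewrite ler_wpM2l.
by rewrite mulrCA gtr_pMr// ltr_pdivrMr// mul1r ltrDl.
Qed.


Definition strip_ge U lam (l : R) : Prop :=
  forall i y, (i <= m)%N -> closure Omega y -> h y <= lam - l ->
    0 <= U i (rf lam y) - U i y.

(** Apply the barrier argument with A = e for every e > 0. *)
Lemma refl_ge0_lower U lam l : positive_chain U -> lam <= lam0 -> 0 < l <= 1 ->
  strip_ge U lam l -> refl_ge U lam 0 m -> forall i, (i <= m)%N -> refl_ge U lam 0 i.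
Proof.
move=> pU lam_le l01 strip wm i; rewrite leq_eqVlt => /predU1P[->//|im] y cy hy.
apply/ler_addgt0Pr => e e0; rewrite -lerBlDr sub0r.
have [cU _] := pU; have /andP[l0 l1] := l01.
have rfl z : closure Omega z -> h z < lam -> Omega (rf lam z) by move=> cz; exact: rfO.
have We z : closure Omega z -> h z <= lam -> - e <= U m (rf lam z) - U m z.
  by move=> cz hz; apply: le_trans (wm z cz hz); rewrite oppr_le0 ltW.
have U0 j z : (j <= m)%N -> 0 <= U j z by exact: positive_chain_ge0.
have := @narrow_strip_iter R n Omega m oO cO x0 nu lam nu1 rfl U l e cU U0 e0 l01
  We strip i y im cy hy.
by apply: le_trans; rewrite lerN2 ler_piMr ?(ltW e0)// expr_le1// ltW.
Qed.

Lemma refl_argmin U lam : positive_chain U -> 0 < lam ->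
  exists k, [/\ closure Omega k, h k <= lam & refl_ge U lam (U m (rf lam k) - U m k) m].
Proof.
move=> [[cU _ _ _] _] lam_gt.
pose K := closure Omega `&` [set z | h z <= lam].
have cK : compact K.
  apply: (subclosed_compact _ cO); last by move=> z [].
  apply: closedI; first exact: closed_closure.
  rewrite (_ : [set z | _] = (fun z => h z) @^-1` `]-oo, lam]%classic); last first.
    by apply/seteqP; split=> z /=; rewrite in_itv.
  by apply: closed_comp => [z _|]; [exact: continuous_height|exact: interval_closed].
have Kx0 : K x0 by split => //=; rewrite height_x0 ltW.
have cg : continuous (fun z => U m (rf lam z) - U m z).
  move=> z; apply: (@cvgB _ _ _ (nbhs z) _ (U m \o rf lam) (U m)); last exact: cU.
  by apply: continuous_comp; [exact: continuous_refl|exact: cU].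
have [k kK kmin] := EVT_min_rV (ex_intro _ x0 Kx0) cK (continuous_subspaceT cg).
move: kK; rewrite inE => -[ck hk]; exists k; split => // y cy hy.
by apply: kmin; rewrite inE.
Qed.

Lemma narrow_region U V (p q : R) : 1 <= p -> 1 <= q ->
  positive_chain U -> positive_chain V ->
  (forall x, Omega x -> frac_laplacian 2^-1 (U m) x = V 0%N x `^ p) ->
  (forall x, Omega x -> frac_laplacian 2^-1 (V m) x = U 0%N x `^ q) ->
  exists2 l : R, 0 < l <= 1 & forall lam, 0 < lam -> lam <= lam0 ->
    strip_ge U lam l -> strip_ge V lam l ->
    forall i, (i <= m)%N -> refl_ge U lam 0 i /\ refl_ge V lam 0 i.
Proof.
move=> p1 q1 pU pV eqU eqV.
have [lU lU0 HU] := narrow_region_half p1 pU pV eqU.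
have [lV lV0 HV] := narrow_region_half q1 pV pU eqV.
pose l := Num.min 1 (Num.min lU lV).
have : l <= Num.min 1 (Num.min lU lV) by [].
rewrite !le_min => /and3P[l1 llU llV].
have l01 : 0 < l <= 1 by rewrite l1 andbT !lt_min ltr01 lU0.
exists l => // lam lam_gt lam_le sU sV.
have [k1 [ck1 hk1 w1]] := refl_argmin pU lam_gt.
have [k2 [ck2 hk2 w2]] := refl_argmin pV lam_gt.
have {}HU (a : R) : U m (rf lam k1) - U m k1 = a -> refl_ge U lam a m ->
    refl_ge V lam a m -> 0 <= a.
  move=> Ea Ua Va; rewrite leNgt; apply/negP => a0.
  by apply: (HU l lam (- a) k1) => //; rewrite ?opprK ?oppr_gt0.
have {}HV (a : R) : V m (rf lam k2) - V m k2 = a -> refl_ge V lam a m ->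
    refl_ge U lam a m -> 0 <= a.
  move=> Ea Ua Va; rewrite leNgt; apply/negP => a0.
  by apply: (HV l lam (- a) k2) => //; rewrite ?opprK ?oppr_gt0.
have [a Ea] : exists a, U m (rf lam k1) - U m k1 = a by eexists.
have [b Eb] : exists b, V m (rf lam k2) - V m k2 = b by eexists.
rewrite Ea in w1; rewrite Eb in w2.
have weak W (c d : R) : c <= d -> refl_ge W lam d m -> refl_ge W lam c m.
  by move=> cd Wd y cy hy; apply: le_trans cd _; exact: Wd.
have [a0 b0] : 0 <= a /\ 0 <= b.
  (* Only the smaller minimum bounds both families from below; once it is nonnegative, so is the
     larger. *)
  have [ab|ba] := leP a b.
    have a0 : 0 <= a by apply: HU Ea w1 _; exact: weak w2.
    by split => //; exact: le_trans ab.
  have b0 : 0 <= b by apply: HV Eb w2 _; apply: weak w1; exact: ltW.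
  by split => //; exact: le_trans (ltW ba).
move=> i im; split.
  by apply: (refl_ge0_lower pU lam_le l01 sU _ im); exact: weak w1.
by apply: (refl_ge0_lower pV lam_le l01 sV _ im); exact: weak w2.
Qed.

(** Strong maximum principle: at a zero minimum x of w, the points near x0, where w is bounded below
    by a positive number, contribute strictly because their kernel exceeds that of their mirror
    images. *)
Lemma frac_laplacian_refl_lt (W : 'rV[R]_n -> R) lam x :
  continuous W -> 0 < lam -> lam <= lam0 -> Omega x -> h x < lam ->
  0 < frac_laplacian 2^-1 W x -> 0 < frac_laplacian 2^-1 W (rf lam x) ->
  W (rf lam x) - W x = 0 ->
  (forall y, h y <= lam -> 0 <= W (rf lam y) - W y) ->
  0 < W (rf lam x0) - W x0 ->
  frac_laplacian 2^-1 W (rf lam x) < frac_laplacian 2^-1 W x.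
Proof.
move=> cW lam_gt lam_le Ox hx P1 P2 wx wge wx0.
have [C0 _] := frac_laplacian_gt0 P1.
pose e : R := n%:R + 2 * 2^-1.
have e0 : 0 < e by rewrite ltr_wpDl.
have [s sE] : exists s, s = rf lam by eexists.
have sC : continuous s by rewrite sE; exact: continuous_refl.
pose a := enorm (x - x0); pose b := enorm (x - s x0).
have a0 : 0 < a by rewrite enorm_gt0 subr_eq0; apply/eqP => xx0; apply: nOx0; rewrite -xx0.
have ab : a < b.
  rewrite -(@ltr_pXn2r _ 2) ?nnegrE ?enorm_ge0// /b sE (sqr_enorm_refl x0 lam nu1 x x0).
  by rewrite ltrDl height_x0 subr0 !mulr_gt0// subr_gt0.
(* A third of the gap keeps a + d < b - d, so the two kernels stay separated uniformly near x0. *)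
pose d := (b - a) / 3.
have d0 : 0 < d by rewrite divr_gt0// subr_gt0.
have adbd : a + d < b - d by exact: add_third_lt.
pose ka := ((a + d) `^ e)^-1; pose kb := ((b - d) `^ e)^-1.
have ad0 : 0 < a + d by rewrite addr_gt0.
have bd0 : 0 < b - d by exact: lt_trans adbd.
have kab : kb < ka.
  rewrite ltf_pV2 ?posrE ?powR_gt0// gt0_ltr_powR ?nnegrE//; exact: ltW.
pose w0 := W (s x0) - W x0.
have {}wx0 : 0 < w0 by rewrite /w0 sE.
pose c := w0 / 2 * (ka - kb).
have c0 : 0 < c by rewrite mulr_gt0 ?subr_gt0// divr_gt0.
have cen : continuous (fun y => enorm (x - y)).
  move=> y; apply: (@continuous_comp _ _ _ (fun y => x - y) (@enorm R n)); last exact: continuous_enorm.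
  apply: (@cvgB _ _ _ (nbhs y) _ (fun=> x) id); first exact: cvg_cst.
  exact: (@cvg_id _ (nbhs y)).
have cens : continuous (fun y => enorm (x - s y)).
  by move=> y; apply: (@continuous_comp _ _ _ s (fun y => enorm (x - y))); [exact: sC|exact: cen].
have cw : continuous (fun y => W (s y) - W y).
  move=> y; apply: (@cvgB _ _ _ (nbhs y) _ (W \o s) W); last exact: cW.
  by apply: continuous_comp; [exact: sC|exact: cW].
have n1 : \forall y \near x0, enorm (x - y) < a + d.
  by apply: (cvgr_lt _ (cen x0)); rewrite ltrDl.
have n2 : \forall y \near x0, a / 2 < enorm (x - y).
  by apply: (cvgr_gt _ (cen x0)); rewrite ltr_pdivrMr// ltr_pMr// ltr1n.
have n3 : \forall y \near x0, b - d < enorm (x - s y).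
  by apply: (cvgr_gt _ (cens x0)); rewrite gtrBl.
have n4 : \forall y \near x0, w0 / 2 < W (s y) - W y.
  by apply: (cvgr_gt _ (cw x0)); rewrite ltr_pdivrMr// ltr_pMr// ltr1n.
have n5 : \forall y \near x0, h y < lam.
  by apply: (cvgr_lt _ (@continuous_height _ _ x0 nu x0)); rewrite height_x0.
have : \forall y \near x0, [/\ enorm (x - y) < a + d, a / 2 < enorm (x - y),
    b - d < enorm (x - s y), w0 / 2 < W (s y) - W y & h y < lam].
  by near=> y; split; near: y.
move=> /nbhs_ballP[r /= r0 Hr].
have a20 : 0 < a / 2 by rewrite divr_gt0.
have wx' : W (rf lam x) - W x <= 0 by rewrite wx.
have wmin y : h y <= lam -> W (rf lam x) - W x <= W (rf lam y) - W y.
  by move=> hy; rewrite wx; exact: wge.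
have H := @frac_laplacian_refl_le R n x0 nu lam nu1 W x cW hx x0 r c (a / 2)
  P1 P2 wx' wmin r0 (ltW c0) a20.
rewrite -subr_lt0; apply: le_lt_trans (H _) _; last first.
  by rewrite oppr_lt0 mulr_gt0// divr_gt0// mulr_gt0// exprn_gt0// mulr_gt0.
move=> y /Hr[y1 y2 y3 y4 y5]; split => //; first exact: ltW.
rewrite wx -sE sub0r add0r.
have k1 : ka <= riesz_kernel x y.
  by apply: riesz_kernel_ge; [exact: lt_trans y2|exact: ltW].
have k2 : riesz_kernel x (s y) <= kb by apply: riesz_kernel_le => //; exact: ltW.
exact: weighted_gap_le (ltW wx0) (ltW y4) (ltW kab) k1 k2.
Unshelve. all: by end_near.
Qed.

(** Downward induction from m. A zero of w_m contradicts the equation, since V_0 does not decrease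
    under reflection; a zero of w_i with i < m is an interior minimum and forces w_{i+1} <= 0. On
    the boundary of Omega only the reflected term remains. *)
Lemma refl_gt0 U V (p : R) lam : 1 <= p -> positive_chain U -> positive_chain V ->
  (forall x, Omega x -> frac_laplacian 2^-1 (U m) x = V 0%N x `^ p) ->
  0 < lam -> lam <= lam0 ->
  (forall i, (i <= m)%N -> refl_ge U lam 0 i) -> refl_ge V lam 0 0%N ->
  forall i y, (i <= m)%N -> closure Omega y -> h y < lam ->
    0 < U i (rf lam y) - U i y.
Proof.
move=> p1 pU pV eqU lam_gt lam_le wU wV.
have [[cU U0 CU NU] Up] := pU; have [_ Vp] := pV.
have bd i y : (i <= m)%N -> closure Omega y -> h y < lam -> ~ Omega y ->
    0 < U i (rf lam y) - U i y.
  move=> im cy hy Oy; rewrite (U0 i y)// subr0 Up//; exact: rfO.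
suff H j : (j <= m)%N -> forall y, Omega y -> h y < lam ->
    0 < U (m - j)%N (rf lam y) - U (m - j)%N y.
  move=> i y im cy hy; have [Oy|Oy] := pselect (Omega y); last exact: bd.
  by rewrite -(subKn im); apply: H => //; exact: leq_subr.
elim: j => [_|j IH jm] y Oy hy.
  have cy : closure Omega y by exact: subset_closure.
  have Ory : Omega (rf lam y) by exact: rfO.
  rewrite subn0 lt_neqAle wU ?(ltW hy)// andbT; apply/negP => /eqP/esym wy.
  have Pf z : Omega z -> 0 < frac_laplacian 2^-1 (U m) z.
    by move=> Oz; rewrite eqU// powR_gt0// Vp.
  have wge z : h z <= lam -> 0 <= U m (rf lam z) - U m z.
    move=> hz; have [cz|cz] := pselect (closure Omega z); first exact: wU.
    by apply: positive_chain_out => // Oz; apply: cz; exact: subset_closure.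
  have wx0 : 0 < U m (rf lam x0) - U m x0 by apply: bd; rewrite ?height_x0.
  have := frac_laplacian_refl_lt (cU m (leqnn m)) lam_gt lam_le Oy hy (Pf _ Oy) (Pf _ Ory)
    wy wge wx0.
  rewrite !eqU// ltNge ge0_ler_powR//.
  - by apply: le_trans p1.
  - by rewrite nnegrE ltW// Vp.
  - by rewrite nnegrE ltW// Vp.
  - by have := wV y cy (ltW hy); rewrite subr_ge0.
have cy : closure Omega y by exact: subset_closure.
have Ory : Omega (rf lam y) by exact: rfO.
have mj : (m - j.+1 < m)%N by rewrite ltn_subrL (leq_trans _ jm).
have mjm := ltnW mj.
rewrite lt_neqAle wU ?(ltW hy)// andbT; apply/negP => /eqP/esym wy.
(* The barrier lemma with A = 0. *)
have gloc : \forall z \near y,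
    U (m - j.+1)%N (rf lam y) - U (m - j.+1)%N y - 0 * (lam - h y) ^+ 2 <=
    U (m - j.+1)%N (rf lam z) - U (m - j.+1)%N z - 0 * (lam - h z) ^+ 2.
  have n1 : \forall z \near y, Omega z by exact: open_nbhs_nbhs.
  have n2 : \forall z \near y, h z < lam.
    by apply: (cvgr_lt _ (@continuous_height _ _ x0 nu y)).
  near=> z; rewrite !mul0r !subr0 wy; apply: wU => //.
    by apply: subset_closure; near: z; exact: n1.
  by apply: ltW; near: z; exact: n2.
have := neg_laplacian_refl_at_min nu1 oO (CU _ mj) Oy Ory gloc.
rewrite (NU _ _ mj Oy) (NU _ _ mj Ory) subnSK// mulr0 oppr0 leNgt => /negP; apply.
exact: (IH (ltnW jm)).
Unshelve. all: by end_near.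
Qed.

End moving_plane.

Lemma sub_half_le {R : realType} (a s l : R) : a < s + l / 2 -> a - l <= s - l / 2.
Proof. lra. Qed.

(** * Advancing the plane *)

Section continuation.
Context {R : realType} {n : nat}.
Variables (Omega : set 'rV[R]_n) (m : nat) (x0 nu : 'rV[R]_n) (lam0 : R).
Implicit Types (x y z : 'rV[R]_n) (U V : nat -> 'rV[R]_n -> R) (lam : R).
Hypotheses (m0 : (0 < m)%N) (oO : open Omega) (cO : compact (closure Omega)).
Hypotheses (cx0 : closure Omega x0) (nOx0 : ~ Omega x0) (nu1 : dot nu nu = 1).
Local Notation h y := (dot (y - x0) nu).
Local Notation rf := (refl x0 nu).
Hypothesis h_ge0 : forall y, closure Omega y -> 0 <= h y.
Hypothesis rfO : forall lam y, closure Omega y -> lam <= lam0 -> h y < lam ->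
  Omega (rf lam y).

Lemma cvg_refl {T : Type} (F : set_system T) {FF : Filter F}
    (f : T -> 'rV[R]_n) (g : T -> R) y s :
  f @ F --> y -> g @ F --> s -> rf (g t) (f t) @[t --> F] --> rf s y.
Proof.
move=> fy gs; apply: (@cvgD _ _ _ F _ f); first exact: fy.
apply: (@cvgZr_tmp _ _ _ F _ (fun t => 2 * (g t - h (f t)))).
apply: cvgM; first exact: cvg_cst.
apply: cvgB; first exact: gs.
exact: (cvg_comp f (fun y => h y) fy (@continuous_height _ _ x0 nu y)).
Qed.

Lemma compact_near_refl (W : 'rV[R]_n -> R) (K : set 'rV[R]_n) s :
  continuous W -> compact K -> (forall y, K y -> 0 < W (rf s y) - W y) ->
  \forall lam \near s, forall y, K y -> 0 < W (rf lam y) - W y.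
Proof.
move=> cW /compact_near_coveringP cK WK.
apply: (cK _ (nbhs s) (fun lam y => 0 < W (rf lam y) - W y)) => y Ky.
have c : (W (rf z.2 z.1) - W z.1) @[z --> filter_prod (nbhs y) (nbhs s)]
    --> W (rf s y) - W y.
  have c1 : z.1 @[z --> filter_prod (nbhs y) (nbhs s)] --> y by exact: cvg_fst.
  have c2 : z.2 @[z --> filter_prod (nbhs y) (nbhs s)] --> s by exact: cvg_snd.
  apply: cvgB; last exact: (cvg_comp _ W c1 (cW y)).
  exact: (cvg_comp _ W (cvg_refl c1 c2) (cW _)).
exact: (cvgr_gt _ c _ (WK y Ky)).
Qed.

Lemma near_forall_le {T : Type} (F : set_system T) {FF : Filter F}
    (Q : nat -> T -> Prop) (k : nat) :
  (forall i, (i <= k)%N -> \forall t \near F, Q i t) ->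
  \forall t \near F, forall i, (i <= k)%N -> Q i t.
Proof.
elim: k => [|k IH] HQ.
  by apply: filterS (HQ 0%N isT) => t Q0 i; rewrite leqn0 => /eqP ->.
have H1 : \forall t \near F, forall i, (i <= k)%N -> Q i t.
  by apply: IH => i ik; apply: HQ; exact: leqW.
apply: filterS2 H1 (HQ k.+1 (leqnn _)) => t Qk Qk1 i.
by rewrite leq_eqVlt => /predU1P[->//|]; exact: Qk.
Qed.

(** For lam < s + l/2 the points of height at most lam - l lie in the compact set [K], on which
    strict positivity persists for lam near s. At s = 0 this set is empty, whence the guard 0 <
    s. *)
Lemma near_strip U s (l : R) : positive_chain Omega m U -> 0 <= s -> 0 < l ->
  (0 < s -> forall i y, (i <= m)%N -> closure Omega y -> h y < s ->
     0 < U i (rf s y) - U i y) ->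
  \forall lam \near s, strip_ge Omega m x0 nu U lam l.
Proof.
move=> [[cU _ _ _] _] s0 l0 Us.
have l20 : 0 < l / 2 by rewrite divr_gt0.
pose K := closure Omega `&` [set z | h z <= s - l / 2].
have cK : compact K.
  apply: (subclosed_compact _ cO); last by move=> z [].
  apply: closedI; first exact: closed_closure.
  rewrite (_ : [set z | _] = (fun z => h z) @^-1` `]-oo, (s - l / 2)]%classic); last first.
    by apply/seteqP; split=> z /=; rewrite in_itv.
  by apply: closed_comp => [z _|]; [exact: continuous_height|exact: interval_closed].
have n1 : \forall lam \near s, forall i, (i <= m)%N ->
    forall y, K y -> 0 < U i (rf lam y) - U i y.
  apply: (@near_forall_le _ (nbhs s)) => i im.
  apply: (@compact_near_refl (U i) K s (cU i im) cK).
  move=> y [cy /= hy].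
  have hys : h y < s by rewrite (le_lt_trans hy)// gtrBl.
  by apply: Us => //; exact: le_lt_trans (h_ge0 cy) hys.
have n2 : \forall lam \near s, lam < s + l / 2.
  by apply: (cvgr_lt _ (@cvg_id _ (nbhs s))); rewrite ltrDl.
apply: filterS2 n1 n2 => lam n1 n2 i y im cy hy.
apply/ltW/n1 => //; split => //=; apply: le_trans hy _.
exact: sub_half_le.
Qed.

Lemma moving_plane U V (p q : R) : 0 < lam0 -> 1 <= p -> 1 <= q ->
  positive_chain Omega m U -> positive_chain Omega m V ->
  (forall x, Omega x -> frac_laplacian 2^-1 (U m) x = V 0%N x `^ p) ->
  (forall x, Omega x -> frac_laplacian 2^-1 (V m) x = U 0%N x `^ q) ->
  forall lam, 0 < lam -> lam <= lam0 -> forall i, (i <= m)%N ->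
    refl_ge Omega x0 nu U lam 0 i /\ refl_ge Omega x0 nu V lam 0 i.
Proof.
move=> lam0_gt p1 q1 pU pV eqU eqV.
have [l /andP[l0 l1] HN] :=
  narrow_region m0 oO cO cx0 nu1 h_ge0 rfO p1 q1 pU pV eqU eqV.
pose P lam := forall i, (i <= m)%N ->
    refl_ge Omega x0 nu U lam 0 i /\ refl_ge Omega x0 nu V lam 0 i.
(* 0 belongs to [S] vacuously, so starting the planes and advancing them are one and the same
   step. *)
pose S := [set s : R | 0 <= s <= lam0 /\ forall mu, 0 < mu <= s -> P mu].
have S0 : S 0.
  by split=> [|mu /andP[/lt_le_trans h /h]]; rewrite ?lexx ?ltW// ltxx.
have Sub : ubound S lam0 by move=> s [/andP[]].
have hS : has_sup S by split; [exists 0|exists lam0].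
pose s := sup S.
have s0 : 0 <= s by apply: ub_le_sup => //; exists lam0.
have sl : s <= lam0 by apply: ge_sup => //; exists 0.
have Plt mu : 0 < mu -> mu < s -> P mu.
  move=> mu0 mus; have [e [_ Se] mue] := sup_gt (ex_intro _ 0 S0) mus.
  by apply: Se; rewrite mu0 ltW.
have left_limit W i : positive_chain Omega m W -> (i <= m)%N -> 0 < s ->
    (forall mu, 0 < mu -> mu < s -> refl_ge Omega x0 nu W mu 0 i) ->
    refl_ge Omega x0 nu W s 0 i.
  move=> [[cW _ _ _] _] im s_gt Wmu y cy; rewrite le_eqVlt => /predU1P[hy|hy].
    by rewrite refl_plane// subrr.
  have c : (W i (rf mu y) - W i y) @[mu --> s^'-] --> W i (rf s y) - W i y.
    apply: cvgB; last exact: cvg_cst.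
    have c1 : mu @[mu --> s^'-] --> s by exact: cvg_at_left_filter.
    have c2 : rf mu y @[mu --> s^'-] --> rf s y.
      by apply: (@cvg_refl _ _ _ (fun=> y) id) => //; exact: cvg_cst.
    exact: (cvg_comp (fun mu => rf mu y) (W i) c2 (cW i im _)).
  apply: (cvgr_to_ge c); near=> mu; apply: Wmu => //; near: mu; exact: nbhs_left_ge.
have Ps : 0 < s -> P s.
  move=> s_gt i im; split; apply: left_limit => // mu mu0 mus.
    exact: (Plt mu mu0 mus i im).1.
  exact: (Plt mu mu0 mus i im).2.
have Ple mu : 0 < mu -> mu <= s -> P mu.
  move=> mu_gt; rewrite le_eqVlt => /predU1P[mus|]; last exact: Plt.
  by rewrite mus in mu_gt *; exact: Ps.
suff -> : lam0 = s by move=> lam; exact: Ple.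
(* If s < lam0, [near_strip] and the narrow-region step carry the planes beyond s. *)
apply/eqP; rewrite eq_le sl andbT leNgt; apply/negP => slt.
have nU : \forall lam \near s, strip_ge Omega m x0 nu U lam l.
  apply: near_strip => // s_gt i y im cy hy.
  apply: (refl_gt0 oO cx0 nOx0 nu1 rfO p1 pU pV eqU s_gt sl) => //.
    by move=> j jm; exact: (Ps s_gt j jm).1.
  exact: (Ps s_gt 0%N isT).2.
have nV : \forall lam \near s, strip_ge Omega m x0 nu V lam l.
  apply: near_strip => // s_gt i y im cy hy.
  apply: (refl_gt0 oO cx0 nOx0 nu1 rfO q1 pV pU eqV s_gt sl) => //.
    by move=> j jm; exact: (Ps s_gt j jm).2.
  exact: (Ps s_gt 0%N isT).1.
have nl : \forall lam \near s, lam <= lam0.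
  by apply: (cvgr_le _ (@cvg_id _ (nbhs s))).
have : \forall lam \near s, [/\ strip_ge Omega m x0 nu U lam l,
    strip_ge Omega m x0 nu V lam l & lam <= lam0].
  by near=> lam; split; near: lam.
move=> /nbhs_ballP[e /= e0 He].
have e20 : 0 < e / 2 by rewrite divr_gt0.
have Sse : S (s + e / 2).
  have near_s mu : s <= mu -> mu <= s + e / 2 -> ball s e mu.
    move=> smu mue; rewrite -ball_normE /= ler0_norm ?subr_le0// opprB.
    rewrite ltrBlDl; apply: le_lt_trans mue _; rewrite ltrD2l.
    by rewrite ltr_pdivrMr// ltr_pMr// ltr1n.
  have [_ _ sel] := He _ (near_s (s + e / 2) ltac:(by rewrite lerDl ltW) (lexx _)).
  split; first by rewrite sel andbT addr_ge0// ltW.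
  move=> mu /andP[mu0 mue]; have [mus|smu] := leP mu s; first exact: Ple.
  have [sU sV mul] := He _ (near_s mu (ltW smu) mue).
  exact: HN.
have : s + e / 2 <= s := ub_le_sup (ex_intro _ lam0 Sub) Sse.
by rewrite gerDl leNgt e20.
Unshelve. all: by end_near.
Qed.

End continuation.

Section conclusion.
Context {R : realType} {n : nat}.
Implicit Types (Omega : set 'rV[R]_n) (nu x : 'rV[R]_n) (u v : 'rV[R]_n -> R).

(** x + t nu is the mirror image of x in the plane of height h x + t/2, which is at most [lam0]
    because the upper point is in the cap. *)
Lemma increasing_of_refl_gt0 Omega x0 nu (lam0 : R) (W : 'rV[R]_n -> R) :
  dot nu nu = 1 ->
  (forall lam y, 0 < lam -> lam <= lam0 -> closure Omega y ->
    dot (y - x0) nu < lam -> 0 < W (refl x0 nu lam y) - W y) ->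
  strictly_increasing_along nu W (cap Omega x0 nu lam0).
Proof.
move=> nu1 HW x t t0 [cx /andP[hx0 hx]] [_ /andP[_ hxt]].
have hE : dot (x + t *: nu - x0) nu = dot (x - x0) nu + t.
  by rewrite addrAC [LHS]dotDl dotZl nu1 mulr1.
rewrite hE in hxt.
have t20 : 0 < t / 2 by rewrite divr_gt0.
have lam_le : dot (x - x0) nu + t / 2 <= lam0.
  by apply: le_trans hxt; rewrite lerD2l ler_pdivrMr// ler_pMr// ler1n.
have -> : x + t *: nu = refl x0 nu (dot (x - x0) nu + t / 2) x.
  by rewrite /refl addrAC subrr add0r mulrC divfK.
by rewrite -subr_gt0; apply: HW => //; [exact: ltr_wpDl|rewrite ltrDl].
Qed.

Lemma solution_class_chain Omega (eps : R) u :
  odd n -> open Omega -> solution_class Omega eps u -> navier_exterior Omega u ->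
  navier_chain Omega n.-1./2 (fun i => neg_laplacian_iter Omega i u).
Proof.
move=> nodd oO [_ Cu] nav; split.
- by move=> i im; exact: neg_laplacian_iter_continuous.
- by move=> i x im Ox; exact: nav.
- by move=> i im; exact: (neg_laplacian_iter_C2 nodd oO Cu im).1.
- by move=> i x im; exact: (neg_laplacian_iter_C2 nodd oO Cu im).2.
Qed.

End conclusion.

Theorem theorem1p2 (R : realType) (n : nat) (Omega : set 'rV[R]_n)
    (x0 nu0 : 'rV[R]_n) :
  (3 <= n)%N -> odd n ->
  domain Omega -> bounded_set Omega -> strictly_convex Omega ->
  smooth_boundary Omega ->
  boundary Omega x0 -> inward_unit_normal Omega x0 nu0 ->
  exists2 delta0 : R, 0 < delta0 &
    forall (p q eps : R) (u v : 'rV[R]_n -> R),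
      1 <= p -> 1 <= q -> 1 < p * q -> 0 < eps < 1 ->
      solution_class Omega eps u -> solution_class Omega eps v ->
      positive_in Omega u -> positive_in Omega v ->
      solution Omega p q u v ->
      forall i : nat, (i <= n.-1./2)%N ->
        strictly_increasing_along nu0 (neg_laplacian_iter Omega i u)
          (cap Omega x0 nu0 delta0) /\
        strictly_increasing_along nu0 (neg_laplacian_iter Omega i v)
          (cap Omega x0 nu0 delta0).
Proof.
move=> n3 nodd [oO _ _] bO scO _ bx0 [U [rho [ldf nuE]]].
have [lam0 lam0_gt rfO] := reflected_cap_sub oO bO scO bx0 ldf.
have nu1 := normal_unit ldf.
have h_ge0 := height_ge0 oO scO bx0 ldf.
rewrite -/(normal x0 rho) in nuE; rewrite -nuE in rfO nu1 h_ge0; clear nuE.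
have [cx0 nOx0] : closure Omega x0 /\ ~ Omega x0.
  by case: bx0 => cx0; move/interior_id : (oO) => ->.
have cO := compact_closure bO.
exists lam0 => // p q eps u v p1 q1 _ _ su sv pu pv [equ eqv navu navv].
pose m := n.-1./2.
(* n >= 3 puts level 0 strictly below level m, so z_0 gains the factor l^2 from the barrier. *)
have m0 : (0 < m)%N by rewrite /m half_gt0 -ltnS prednK// (leq_trans _ n3).
pose W w i := neg_laplacian_iter Omega i w.
have W0 w x : Omega x -> W w 0%N x = w x by move=> Ox; rewrite /W neg_laplacian_iter_in.
have eqU x : Omega x -> frac_laplacian 2^-1 (W u m) x = W v 0%N x `^ p.
  by move=> Ox; rewrite W0//; exact: equ.
have eqV x : Omega x -> frac_laplacian 2^-1 (W v m) x = W u 0%N x `^ q.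
  by move=> Ox; rewrite W0//; exact: eqv.
have cU := solution_class_chain nodd oO su navu.
have cV := solution_class_chain nodd oO sv navv.
have pU : positive_chain Omega m (W u).
  split => //; apply: (navier_chain_gt0 oO cO cU) => x Ox.
  by rewrite eqU// W0// powR_gt0// pv.
have pV : positive_chain Omega m (W v).
  split => //; apply: (navier_chain_gt0 oO cO cV) => x Ox.
  by rewrite eqV// W0// powR_gt0// pu.
have MP := moving_plane m0 oO cO cx0 nOx0 nu1 h_ge0 rfO
  lam0_gt p1 q1 pU pV eqU eqV.
move=> i im; split; apply: increasing_of_refl_gt0 => // lam y lam_gt lam_le cy hy.
  apply: (refl_gt0 oO cx0 nOx0 nu1 rfO p1 pU pV eqU lam_gt lam_le) => //.
    by move=> j jm; exact: (MP lam lam_gt lam_le j jm).1.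
  exact: (MP lam lam_gt lam_le 0%N isT).2.
apply: (refl_gt0 oO cx0 nOx0 nu1 rfO q1 pV pU eqV lam_gt lam_le) => //.
  by move=> j jm; exact: (MP lam lam_gt lam_le j jm).2.
exact: (MP lam lam_gt lam_le 0%N isT).1.
Qed.
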